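(* Let $\mathcal{A}=\bigoplus_{k=1}^r\mathbb{C}I_{m_k}$ be a commutative $C^*$-subalgebra of $\mathbb{M}_d$, where $d=\sum_{k=1}^r m_k$. Let $\Sigma_{\mathcal{A}}$ be the compact convex set $$\Sigma_{\mathcal{A}}=\{\tau:\ \tau\text{ is a unital quantum channel on }\mathbb{M}_d\text{ with }\mathcal{A}\subseteq\mathrm{Fix}(\tau)\cap\mathrm{Range}(\tau)'\}.$$ Then there exists a continuous weight function $\rho_{\mathcal{A}}:\Sigma_{\mathcal{A}}\times\mathbb{U}(\mathcal{A}')\times\mathbb{U}(\mathcal{A}')\to\mathbb{R}$ such that every $\tau\in\Sigma_{\mathcal{A}}$ admits the integral representation $$\tau=\int_{U,V\in\mathbb{U}(\mathcal{A}')}\rho_{\mathcal{A}}(\tau,U,V)\,\beta_{U,V}\,\mathrm{d}U\,\mathrm{d}V.$$ Furthermore, $\rho_{\mathcal{A}}(\mathbb{E}_{\mathcal{A}},U,V)=1$ for all $U,V\in\mathbb{U}(\mathcal{A}')$.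
   Context: $\mathbb{M}_d$ is the algebra of $d\times d$ complex matrices and $\mathbb{U}(d)$ its unitary group. $\bigoplus_k\mathbb{C}I_{m_k}$ is the algebra of block-diagonal matrices with scalar diagonal blocks of sizes $m_1,\dots,m_r$. For $S\subseteq\mathbb{M}_d$, $S'$ denotes the commutant in $\mathbb{M}_d$. $\mathbb{U}(\mathcal{A}')=\mathbb{U}(d)\cap\mathcal{A}'$, equipped with normalized Haar measure $\mathrm{d}U$. A quantum channel on $\mathbb{M}_d$ is a completely positive, trace-preserving linear map; $\mathrm{Fix}(\tau)=\{X:\tau(X)=X\}$. $\mathbb{E}_{\mathcal{A}}$ is the trace-preserving conditional expectation of $\mathbb{M}_d$ onto $\mathcal{A}$, i.e. the orthogonal projection onto $\mathcal{A}$ with respect to $\langle X,Y\rangle=\mathrm{Tr}(X^*Y)$. $\mathrm{Ad}_U(X)=UXU^*$; $\Delta_d(X)=\sum_{j=1}^d\langle e_j,Xe_j\rangle|e_j\rangle\langle e_j|$ with $\{e_j\}$ the standard basis of $\mathbb{C}^d$; $\beta_{U,V}=\mathrm{Ad}_U\circ\Delta_d\circ\mathrm{Ad}_{V^*}$. *)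

(* Defs.v *)
From HB Require Import structures.
From mathcomp Require Import all_boot all_order all_algebra.
From mathcomp Require Import complex.
From mathcomp Require Import all_classical all_reals all_analysis.

Set Implicit Arguments.
Unset Strict Implicit.
Unset Printing Implicit Defensive.

Import Order.TTheory GRing.Theory Num.Theory.
Import numFieldNormedType.Exports.

Local Open Scope classical_set_scope.
Local Open Scope ring_scope.
Local Open Scope complex_scope.
Local Open Scope sesquilinear_scope.

(* The topology of C = R[i] is that of its modulus; the topology of matrices
   over R[i] is then the library's. *)
HB.instance Definition _ (R : realType) :=
  NormedModule.copy R[i] (R[i] : numClosedFieldType)^o.
HB.instance Definition _ (R : realType) :=
  PseudoPointedMetric.copy R[i] (R[i] : numClosedFieldType)^o.

Section matrix_algebra.
Context {R : realType} {d : nat}.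
Local Notation M := 'M[R[i]]_d.

Definition commutant (S : set M) : set M :=
  [set X | forall Y, S Y -> X *m Y = Y *m X].

Definition unitary_group (S : set M) : set M :=
  [set U | U \is unitarymx] `&` S.

Definition hs_dot (X Y : M) : R[i] := \tr (X ^t* *m Y).

(* Orthogonal projection of X onto the subspace A: the (unique) element E of A
   with X - E orthogonal to A. *)
Definition cond_exp (A : set M) (X : M) : M :=
  xget 0 [set E | A E /\ forall Y, A Y -> hs_dot Y (X - E) = 0].

Definition psd n (Z : 'M[R[i]]_n) : Prop :=
  forall x : 'cV[R[i]]_n, 0 <= (x ^t* *m Z *m x) 0 0.

(* id_n (x) tau, acting on n x n matrices of d x d blocks. *)
Definition ampliation n (tau : M -> M) (Z : 'M[R[i]]_(\sum_(i < n) d)) :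
    'M[R[i]]_(\sum_(i < n) d) :=
  \mxblock_(i < n, j < n) tau (submxblock Z i j).

Definition completely_positive (tau : M -> M) : Prop :=
  forall n (Z : 'M[R[i]]_(\sum_(i < n) d)), psd Z -> psd (ampliation tau Z).

Definition quantum_channel (tau : M -> M) : Prop :=
  [/\ linear tau, completely_positive tau & forall X, \tr (tau X) = \tr X].

Definition unital (tau : M -> M) : Prop := tau 1%:M = 1%:M.

Definition Fix (tau : M -> M) : set M := [set X | tau X = X].

(* On linear maps of a finite-dimensional space, the topology of pointwise
   convergence is the usual norm topology. *)
Definition Sigma (A : set M) : set {ptws M -> M} :=
  [set tau | [/\ quantum_channel tau, unital tau &
                 A `<=` Fix tau `&` commutant (range tau)]].

Definition Ad (U : M) (X : M) : M := U *m X *m U ^t*.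

Definition Delta (X : M) : M := diag_mx (\row_j X j j).

Definition beta (U V : M) : M -> M := Ad U \o Delta \o Ad (V ^t*).

Definition borel_matrix := g_sigma_algebraType (@open M).

(* A Borel probability measure on the group G of matrices is encoded as a Borel
   probability measure on all matrices that gives G mass 1. *)
Definition normalized_haar (G : set M) (mu : probability borel_matrix R) : Prop :=
  mu G = 1%E /\
  forall U (B : set borel_matrix), G U -> measurable B ->
    mu [set U *m V | V in B] = mu B.

End matrix_algebra.

Arguments borel_matrix : clear implicits.

Definition scalar_blocks {R : realType} {r : nat} (m : 'I_r -> nat) :
    set 'M[R[i]]_(\sum_(k < r) m k) :=
  range (fun c : 'I_r -> R[i] => \mxdiag_(k < r) (c k)%:M).

Arguments scalar_blocks {R r} m.

Section matrix_integral.
Context {R : realType} {d : nat} {disp : measure_display}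
  {T : measurableType disp}.
Variables (mu : {measure set T -> \bar R}) (D : set T).

Definition cintegral (f : T -> R[i]) : R[i] :=
  (\int[mu]_(x in D) complex.Re (f x)) +i* (\int[mu]_(x in D) complex.Im (f x)).

Definition mxintegral (f : T -> 'M[R[i]]_d) : 'M[R[i]]_d :=
  \matrix_(i, j) cintegral (fun x => f x i j).

End matrix_integral.

(* Main.v *)
(* A channel tau in Sigma_A fixes A and has range in A', so by positivity of its
   Choi form the entries t(a,b,k,l) = (tau E_ab)_kl vanish unless a, b, k, l lie in
   one block.  Put f = t - e with e the tensor of the conditional expectation, and
     rho(tau,U,V) = 1 + sum_i c_i sum_abkl f(a,b,k,l) U_li U_ki^* V_ai V_bi^*,
   with c_i = (n+1)^2 (n-1), n the size of the block of i.  The constant term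
   integrates to E_A.  In the rest, the fourth moments of U and V are, by
   invariance of Haar measure, combinations p d_ab d_ce + q d_ae d_bc (Weingarten
   formula); the p terms disappear because sum_a f(a,a,k,l) = sum_k f(a,b,k,k) = 0,
   and the q terms reproduce f with factor sum_ij c_i q_ij^2 = 1 on every block of
   size n > 1, while f vanishes on blocks of size 1. *)

Require Import Defs.
From HB Require Import structures.
From mathcomp Require Import all_boot all_order all_algebra.
From mathcomp Require Import perm complex.
From mathcomp Require Import all_classical all_reals all_analysis.
From mathcomp Require Import measurable_realfun ring.

Set Implicit Arguments.
Unset Strict Implicit.
Unset Printing Implicit Defensive.

Import Order.TTheory GRing.Theory Num.Theory.
Import numFieldNormedType.Exports.

Local Open Scope classical_set_scope.
Local Open Scope ring_scope.
Local Open Scope sesquilinear_scope.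

(** Write u_i and v_i for the i-th columns of U and V. The nonconstant part of the weight is the sum
    over i of c_i <u_i, T_i u_i> with T_i the image of |v_i><v_i| under tau - E_A, and beta_{U,V}(X)
    is the sum over j of <v_j, X v_j> |u_j><u_j|. Hence U and V enter the integrand only through
    products in which each column index occurs once plainly and once conjugated, and only such
    moments are computed. The same shape makes the weight real: each summand is a difference of
    values of two positive forms. The group is probed by three explicit kinds of matrices, all
    rank-one perturbations of the identity: a phase in one row, a transposition of two rows of a
    block, and a single rational reflection. These act on rows. The dependence on columns comes from
    their orthonormality, which supplies the remaining linear equations for the moments. The weight
    is affine in tau and polynomial in the entries of U, V and their conjugates; this gives
    continuity, and the value 1 where the defect tensor vanishes. *)

Section continuity.
Local Open Scope complex_scope.
Variable R : realType.
Local Notation C := R[i].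

(** * Continuity of complex-valued functions *)

Lemma normc_ge_Im (z : C) : `|complex.Im z|%:C <= `|z|.
Proof.
have -> : complex.Im z = - complex.Re (z * 'i%C) by rewrite ReiNIm opprK.
rewrite normrN; apply: le_trans (normc_ge_Re _) _.
rewrite normrM (_ : `|'i%C| = 1) ?mulr1//.
by rewrite normc_def/= expr0n/= add0r expr1n sqrtr1.
Qed.

Lemma continuous_Re : continuous (@complex.Re R).
Proof.
move=> z A /nbhs_ballP[e /= e0 eA]; apply/nbhs_ballP; exists e%:C => /=.
  by rewrite ltcR.
move=> w zw; apply: eA; move: zw; rewrite /ball /= => zw.
rewrite -ltcR; apply: le_lt_trans zw.
by rewrite -(raddfB (@complex.Re R : Rcomplex R -> R)) /=; exact: normc_ge_Re.
Qed.

Lemma continuous_Im : continuous (@complex.Im R).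
Proof.
move=> z A /nbhs_ballP[e /= e0 eA]; apply/nbhs_ballP; exists e%:C => /=.
  by rewrite ltcR.
move=> w zw; apply: eA; move: zw; rewrite /ball /= => zw.
rewrite -ltcR; apply: le_lt_trans zw.
by rewrite -(raddfB (@complex.Im R : Rcomplex R -> R)) /=; exact: normc_ge_Im.
Qed.

Lemma continuous_conj : continuous (fun z : C => z^*%C).
Proof.
move=> z A /nbhs_ballP[e /= e0 eA]; apply/nbhs_ballP; exists e => // w zw.
apply: eA; move: zw.
by rewrite /ball /= -[`|_^*%C - _|]normcJ rmorphB /= !conjcK.
Qed.

Variable T : topologicalType.
Implicit Types f g : T -> C.

Lemma continuous_funC_cst (c : C) : continuous (fun _ : T => c).
Proof. by move=> x; exact: cst_continuous. Qed.

Lemma continuous_funCD f g : continuous f -> continuous g ->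
  continuous (fun x => f x + g x).
Proof. by move=> cf cg x; apply: cvgD; [exact: cf|exact: cg]. Qed.

Lemma continuous_funCB f g : continuous f -> continuous g ->
  continuous (fun x => f x - g x).
Proof. by move=> cf cg x; apply: cvgB; [exact: cf|exact: cg]. Qed.

Lemma continuous_funCM f g : continuous f -> continuous g ->
  continuous (fun x => f x * g x).
Proof. by move=> cf cg x; apply: cvgM; [exact: cf|exact: cg]. Qed.

Lemma continuous_funC_conj f : continuous f -> continuous (fun x => (f x)^*%C).
Proof.
by move=> cf x; apply: (@continuous_comp _ _ _ f); [exact: cf|exact: continuous_conj].
Qed.

Lemma continuous_funC_sum (I : Type) (r : seq I) (F : I -> T -> C) :
  (forall i, continuous (F i)) -> continuous (fun x => \sum_(i <- r) F i x).
Proof.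
move=> cF; elim: r => [|i r IH].
  rewrite (_ : (fun x => _) = fun=> 0); first exact: continuous_funC_cst.
  by apply/funext => x; rewrite big_nil.
rewrite (_ : (fun x => _) = fun x => F i x + \sum_(j <- r) F j x).
  exact: continuous_funCD (cF i) IH.
by apply/funext => x; rewrite big_cons.
Qed.

(** Serves to present the unitary group of a commutant as an intersection of closed zero sets. *)
Lemma closed_zeros f : continuous f -> closed [set x | f x = 0].
Proof.
move=> cf; apply: (@closed_comp _ _ f [set 0]) => [x _|]; first exact: cf.
apply/accessible_closed_set1/hausdorff_accessible; exact: norm_hausdorff.
Qed.

End continuity.

(** * Complex integrals *)

Section complex_integral.
Local Open Scope complex_scope.
Context {R : realType} {disp : measure_display} {T : measurableType disp}.
Variables (mu : {measure set T -> \bar R}) (D : set T).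
Hypotheses (mD : measurable D) (finD : (mu D < +oo)%E).
Local Notation C := R[i].
Implicit Types f g : T -> C.

(** Measurability is global, so that it survives translations and projections of products; the bound
    is asked on [D] only, because matrix entries are bounded on the unitary group but not on all
    matrices. The class is closed under sums, products and conjugation, which is all that
    polynomials in entries need for integrability. *)
Definition bounded_mfun f := [/\ measurable_fun setT (@complex.Re R \o f),
  measurable_fun setT (@complex.Im R \o f) &
  exists K : R, forall x, D x -> `|f x| <= K%:C].

Lemma bounded_mfun_cst c : bounded_mfun (fun=> c).
Proof.
split; [exact: measurable_cst|exact: measurable_cst|].
by exists (Num.sqrt (complex.Re c ^+ 2 + complex.Im c ^+ 2)) => x _; rewrite normc_def.
Qed.

Lemma bounded_mfunD f g : bounded_mfun f -> bounded_mfun g ->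
  bounded_mfun (fun x => f x + g x).
Proof.
move=> [rf jf [K fK]] [rg jg [L gL]]; split.
- rewrite (_ : _ \o _ = (@complex.Re R \o f) \+ (@complex.Re R \o g)).
    exact: measurable_funD.
  by apply/funext => x /=; case: (f x) (g x) => [a b] [].
- rewrite (_ : _ \o _ = (@complex.Im R \o f) \+ (@complex.Im R \o g)).
    exact: measurable_funD.
  by apply/funext => x /=; case: (f x) (g x) => [a b] [].
- exists (K + L) => x Dx; rewrite rmorphD /=.
  by apply: le_trans (ler_normD _ _) _; apply: lerD; [exact: fK|exact: gL].
Qed.

Lemma bounded_mfunM f g : bounded_mfun f -> bounded_mfun g ->
  bounded_mfun (fun x => f x * g x).
Proof.
move=> [rf jf [K fK]] [rg jg [L gL]]; split.
- rewrite (_ : _ \o _ = (@complex.Re R \o f) \* (@complex.Re R \o g)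
                      \- (@complex.Im R \o f) \* (@complex.Im R \o g)).
    by apply: measurable_funB; apply: measurable_funM.
  by apply/funext => x /=; case: (f x) (g x) => [a b] [].
- rewrite (_ : _ \o _ = (@complex.Re R \o f) \* (@complex.Im R \o g)
                      \+ (@complex.Im R \o f) \* (@complex.Re R \o g)).
    by apply: measurable_funD; apply: measurable_funM.
  by apply/funext => x /=; case: (f x) (g x) => [a b] [].
- exists (K * L) => x Dx; rewrite rmorphM /= normrM.
  by apply: ler_pM => //; [exact: fK|exact: gL].
Qed.

Lemma bounded_mfun_conj f : bounded_mfun f -> bounded_mfun (fun x => (f x)^*%C).
Proof.
move=> [rf jf [K fK]]; split.
- rewrite (_ : _ \o _ = @complex.Re R \o f)//.
  by apply/funext => x /=; case: (f x).
- rewrite (_ : _ \o _ = \- (@complex.Im R \o f)); first exact: measurable_funN.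
  by apply/funext => x /=; case: (f x).
- by exists K => x Dx; rewrite normcJ fK.
Qed.

Lemma bounded_mfun_sum (I : Type) (r : seq I) (P : pred I) (F : I -> T -> C) :
  (forall i, bounded_mfun (F i)) ->
  bounded_mfun (fun x => \sum_(i <- r | P i) F i x).
Proof.
move=> bF; elim: r => [|i r IH].
  by under eq_fun do rewrite big_nil; exact: bounded_mfun_cst.
under eq_fun do rewrite big_cons.
by case: (P i) => //; apply: bounded_mfunD.
Qed.

Lemma bounded_mfun_integrable f : bounded_mfun f ->
  mu.-integrable D (EFin \o (@complex.Re R \o f)) /\
  mu.-integrable D (EFin \o (@complex.Im R \o f)).
Proof.
move=> [rf jf [K fK]].
have bnd (g : T -> R) : measurable_fun setT g ->
    (forall x, D x -> `|g x|%:C <= `|f x|) -> mu.-integrable D (EFin \o g).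
  move=> mg gf; apply: measurable_bounded_integrable => //.
    exact: measurable_funS mg.
  exists K; split; first exact: num_real.
  move=> L KL x Dx /=; rewrite -lecR; apply: le_trans (gf x Dx) _.
  by apply: le_trans (fK x Dx) _; rewrite lecR ltW.
split; apply: bnd => // x _; first exact: normc_ge_Re.
exact: normc_ge_Im.
Qed.

Lemma eq_cintegral f g : (forall x, D x -> f x = g x) ->
  cintegral mu D f = cintegral mu D g.
Proof.
by move=> fg; congr (_ +i* _); apply: eq_Rintegral => x /set_mem/fg ->.
Qed.

Lemma cintegralD f g : bounded_mfun f -> bounded_mfun g ->
  cintegral mu D (fun x => f x + g x) = cintegral mu D f + cintegral mu D g.
Proof.
move=> /bounded_mfun_integrable[rf jf] /bounded_mfun_integrable[rg jg].
apply/eqP; rewrite eq_complex /=; apply/andP; split; apply/eqP.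
  by rewrite -RintegralD//; apply: eq_Rintegral => x _; case: (f x) (g x) => [? ?] [].
by rewrite -RintegralD//; apply: eq_Rintegral => x _; case: (f x) (g x) => [? ?] [].
Qed.

Lemma cintegralZl c f : bounded_mfun f ->
  cintegral mu D (fun x => c * f x) = c * cintegral mu D f.
Proof.
move=> /bounded_mfun_integrable[rf jf]; case: c => a b.
have Zi (k : R) (g : T -> R) : mu.-integrable D (EFin \o g) ->
    mu.-integrable D (EFin \o (fun x => k * g x)).
  move=> ig; have := integrableZl mD k ig.
  by apply: (eq_integrable mD).

apply/eqP; rewrite eq_complex /=; apply/andP; split; apply/eqP.
  rewrite -!RintegralZl// -RintegralB//; try exact: Zi.
  by apply: eq_Rintegral => x _; case: (f x).
rewrite -!RintegralZl// -RintegralD//; try exact: Zi.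
by apply: eq_Rintegral => x _; case: (f x).
Qed.

Lemma cintegral_sum (I : Type) (r : seq I) (P : pred I) (F : I -> T -> C) :
  (forall i, bounded_mfun (F i)) ->
  cintegral mu D (fun x => \sum_(i <- r | P i) F i x) =
  \sum_(i <- r | P i) cintegral mu D (F i).
Proof.
move=> bF; elim: r => [|i r IH].
  rewrite big_nil /cintegral; under eq_Rintegral do rewrite big_nil.
  under [X in _ +i* X]eq_Rintegral do rewrite big_nil.
  by rewrite /= !Rintegral_cst// mul0r.
rewrite big_cons -IH; case: ifP => Pi.
  rewrite -cintegralD//; last exact: bounded_mfun_sum.
  by apply: eq_cintegral => x _; rewrite big_cons Pi.
by apply: eq_cintegral => x _; rewrite big_cons Pi.
Qed.

Lemma cintegral_cst c : mu D = 1%E -> cintegral mu D (fun=> c) = c.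
Proof. by move=> D1; rewrite /cintegral !Rintegral_cst// D1 !mulr1; case: c. Qed.

End complex_integral.

(** * Integrals of products of functions of separate variables *)

Section product_integral.
Local Open Scope complex_scope.
Context {R : realType} {d1 d2 : measure_display}
  {T1 : measurableType d1} {T2 : measurableType d2}.
Variables (mu1 : probability T1 R) (mu2 : probability T2 R).
Variables (D1 : set T1) (D2 : set T2).
Hypotheses (mD1 : measurable D1) (mD2 : measurable D2).
Local Notation C := R[i].

Let bounded_integrable d (T : measurableType d) (m : {measure set T -> \bar R})
    (f : T -> R) : (m setT < +oo)%E -> measurable_fun setT f ->
  (exists K, forall x, `|f x| <= K) -> m.-integrable setT (EFin \o f).
Proof.
move=> mT mf [K fK]; apply: measurable_bounded_integrable => //.
exists K; split; first exact: num_real.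
by move=> L KL x _ /=; exact: le_trans (fK x) (ltW KL).
Qed.

(** Extension by zero outside [D1] and [D2] makes both functions globally bounded, and the extension
    of the product is the product of the extensions, so Fubini's theorem on the whole product space
    applies. *)
Lemma Rintegral_prod (f : T1 -> R) (g : T2 -> R) :
  measurable_fun setT f -> measurable_fun setT g ->
  (exists K, forall x, D1 x -> `|f x| <= K) ->
  (exists K, forall x, D2 x -> `|g x| <= K) ->
  \int[(mu1 \x mu2)%E]_(z in D1 `*` D2) (f z.1 * g z.2) =
  (\int[mu1]_(x in D1) f x) * (\int[mu2]_(y in D2) g y).
Proof.
move=> mf mg [K fK] [L gL].
rewrite Rintegral_mkcond [X in X * _]Rintegral_mkcond [X in _ * X]Rintegral_mkcond.
have mF : measurable_fun setT (f \_ D1).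
  by apply/(measurable_restrictT f mD1); exact: measurable_funS mf.
have mG : measurable_fun setT (g \_ D2).
  by apply/(measurable_restrictT g mD2); exact: measurable_funS mg.
have FK x : `|(f \_ D1) x| <= `|K|.
  rewrite patchE; case: ifPn => [/set_mem/fK fxK|_]; last by rewrite normr0.
  exact: le_trans fxK (ler_norm _).
have GL x : `|(g \_ D2) x| <= `|L|.
  rewrite patchE; case: ifPn => [/set_mem/gL gxL|_]; last by rewrite normr0.
  exact: le_trans gxL (ler_norm _).
have -> : (fun z : T1 * T2 => f z.1 * g z.2) \_ (D1 `*` D2) =
    (fun z => (f \_ D1) z.1 * (g \_ D2) z.2).
  apply/funext => -[x y]; rewrite !patchE in_setX /=.
  by case: (x \in D1); case: (y \in D2); rewrite /= ?mul0r ?mulr0.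
move: (f \_ D1) (g \_ D2) mF mG FK GL => F G mF mG FK GL.
have iF : mu1.-integrable setT (EFin \o F).
  apply: bounded_integrable => //; last by exists `|K|.
  exact: le_lt_trans (probability_le1 mu1 measurableT) (ltry _).
have iG : mu2.-integrable setT (EFin \o G).
  apply: bounded_integrable => //; last by exists `|L|.
  exact: le_lt_trans (probability_le1 mu2 measurableT) (ltry _).
have iFG : (mu1 \x mu2)%E.-integrable setT (EFin \o (fun z => F z.1 * G z.2)).
  apply: bounded_integrable.
  - rewrite -setXTT.
    rewrite [ltLHS](product_measure1E mu1 mu2 measurableT measurableT).
    by rewrite -ge0_fin_numE ?mule_ge0// fin_numM// fin_num_measure.
  - by apply: measurable_funM; apply: measurableT_comp.
  - by exists (`|K| * `|L|) => -[x y]; rewrite normrM ler_pM.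
rewrite /Rintegral -(integral12_prod_meas1 iFG) /fubini_F /=.
under eq_integral => x _.
  under eq_integral do rewrite EFinM.
  (* The inner integral is finite; written as a real number it becomes a constant factor for the
     outer integral. *)
  rewrite integralZl// -[X in (_ * X)%E]fineK; last exact: integrable_fin_num.
  over.
rewrite integralZr// fineM//; exact: integrable_fin_num.
Qed.

Lemma product_fin : ((mu1 \x mu2)%E (D1 `*` D2) < +oo)%E.
Proof.
rewrite [ltLHS](product_measure1E mu1 mu2 mD1 mD2).
by rewrite -ge0_fin_numE ?mule_ge0// fin_numM// fin_num_measure.
Qed.

Lemma cintegral_prod (f : T1 -> C) (g : T2 -> C) :
  bounded_mfun D1 f -> bounded_mfun D2 g ->
  cintegral (mu1 \x mu2)%E (D1 `*` D2) (fun z => f z.1 * g z.2) =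
  cintegral mu1 D1 f * cintegral mu2 D2 g.
Proof.
move=> bf bg.
have muD := product_fin.
have [[rf jf [K fK]] [rg jg [L gL]]] := (bf, bg).
(* Domination by the moduli of [f] and [g] covers all four combinations of real and imaginary parts
   at once. *)
have Eprod (h1 : T1 -> R) (h2 : T2 -> R) :
    measurable_fun setT h1 -> measurable_fun setT h2 ->
    (forall x, D1 x -> `|h1 x|%:C <= `|f x|) ->
    (forall x, D2 x -> `|h2 x|%:C <= `|g x|) ->
    \int[(mu1 \x mu2)%E]_(z in D1 `*` D2) (h1 z.1 * h2 z.2) =
    (\int[mu1]_(x in D1) h1 x) * (\int[mu2]_(y in D2) h2 y) /\
    (mu1 \x mu2)%E.-integrable (D1 `*` D2) (EFin \o (fun z => h1 z.1 * h2 z.2)).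
  move=> m1 m2 h1f h2g.
  have h1K x : D1 x -> `|h1 x| <= K.
    by move=> Dx; rewrite -lecR; exact: le_trans (h1f _ Dx) (fK _ Dx).
  have h2L x : D2 x -> `|h2 x| <= L.
    by move=> Dx; rewrite -lecR; exact: le_trans (h2g _ Dx) (gL _ Dx).
  split; first by apply: Rintegral_prod => //; [exists K|exists L].
  apply: measurable_bounded_integrable => //; first exact: measurableX.
    apply: (@measurable_funS _ _ _ _ setT) => //.
    by apply: measurable_funM; apply: measurableT_comp.
  exists (K * L); split; first exact: num_real.
  move=> k Kk [x y] [/= /h1K hx /h2L hy]; apply: le_trans (ltW Kk).
  by rewrite normrM ler_pM.
have nf x : D1 x -> `|complex.Re (f x)|%:C <= `|f x| by move=> _; exact: normc_ge_Re.
have ng x : D2 x -> `|complex.Re (g x)|%:C <= `|g x| by move=> _; exact: normc_ge_Re.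
have kf x : D1 x -> `|complex.Im (f x)|%:C <= `|f x| by move=> _; exact: normc_ge_Im.
have kg x : D2 x -> `|complex.Im (g x)|%:C <= `|g x| by move=> _; exact: normc_ge_Im.
have [e1 i1] := Eprod _ _ rf rg nf ng.
have [e2 i2] := Eprod _ _ jf jg kf kg.
have [e3 i3] := Eprod _ _ rf jg nf kg.
have [e4 i4] := Eprod _ _ jf rg kf ng.
have mD : measurable (D1 `*` D2) by exact: measurableX.
apply/eqP; rewrite eq_complex /=; apply/andP; split; apply/eqP.
  rewrite -e1 -e2 -RintegralB//.
  by apply: eq_Rintegral => -[x y] _ /=; case: (f x) (g y) => [? ?] [].
rewrite -e3 -e4 -RintegralD//.
by apply: eq_Rintegral => -[x y] _ /=; case: (f x) (g y) => [? ?] [].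
Qed.

End product_integral.

(** * Haar measure on commutant unitary groups *)

Lemma continuous_matrix (K : numFieldType) (U : pseudoMetricType K)
    (T : topologicalType) m n (f : T -> 'M[U]_(m, n)) :
  (forall i j, continuous (fun x => f x i j)) -> continuous f.
Proof.
move=> cf x. apply/cvg_ballP => e e0.
have h : \forall y \near x, forall ij : 'I_m * 'I_n,
    ball (f x ij.1 ij.2) e (f y ij.1 ij.2).
  apply: filter_forall => -[i j] /=.
  exact: (cf i j x _ (nbhsx_ballx _ _ e0)).
by apply: filterS h => y /= xy; split=> // i j; exact: (xy (i, j)).
Qed.

Section unitary_group.
Local Open Scope complex_scope.
Variables (R : realType) (d : nat).
Local Notation C := R[i].
Local Notation M := 'M[C]_d.
Implicit Types (S : set M) (U V W X : M) (f : M -> C).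

Lemma continuous_entry i j : continuous (fun X : M => X i j).
Proof. exact: coord_continuous. Qed.

Lemma continuous_mulmx_entry W i j : continuous (fun X : M => (W *m X) i j).
Proof.
under eq_fun do rewrite mxE; apply: continuous_funC_sum => k.
by apply: continuous_funCM; [exact: continuous_funC_cst|exact: continuous_entry].
Qed.

Lemma continuous_mulmxr_entry W i j : continuous (fun X : M => (X *m W) i j).
Proof.
under eq_fun do rewrite mxE; apply: continuous_funC_sum => k.
by apply: continuous_funCM; [exact: continuous_entry|exact: continuous_funC_cst].
Qed.

Lemma measurable_open_borel (B : set (borel_matrix R d)) :
  open (B : set M) -> measurable B.
Proof. by move=> oB; exact: sub_sigma_algebra. Qed.

Lemma measurable_closed_borel (B : set (borel_matrix R d)) :
  closed (B : set M) -> measurable B.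
Proof.
by move=> /closed_openC oB; rewrite -(setCK B);
  apply: measurableC; exact: measurable_open_borel.
Qed.

Lemma measurable_fun_continuous (h : M -> R) : continuous h ->
  measurable_fun [set: borel_matrix R d] h.
Proof.
move=> ch; apply: (measurability _ (RGenOInfty.measurableE R)).
move=> _ [_ [a ->] <-]; rewrite setTI; apply: measurable_open_borel.
by apply: open_comp => //; exact: open_gt.
Qed.

Lemma measurable_mulmx W :
  measurable_fun setT (fun X : borel_matrix R d => (W *m X : borel_matrix R d)).
Proof.
apply: (@measurability _ _ (borel_matrix R d) (borel_matrix R d) _ _ (@open M) erefl).
move=> _ [B oB <-]; rewrite setTI; apply: measurable_open_borel.
apply: open_comp => // X _; apply: continuous_matrix => i j.
exact: continuous_mulmx_entry.
Qed.

Lemma continuous_bounded_mfun (D : set (borel_matrix R d)) f : continuous f ->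
  (exists K : R, forall X, D X -> `|f X| <= K%:C) -> bounded_mfun D f.
Proof.
move=> cf bf; split => //; apply: measurable_fun_continuous => X.
  by apply: (@continuous_comp _ _ _ f); [exact: cf|exact: continuous_Re].
by apply: (@continuous_comp _ _ _ f); [exact: cf|exact: continuous_Im].
Qed.

Lemma unitary_conjtr U : U \is unitarymx -> U ^t* *m U = 1%:M.
Proof. by move=> /unitarymxP /mulmx1C. Qed.

(** Unitarity and commutation with each element of [S] are entrywise equations between continuous
    functions; [S] may be infinite, since any intersection of closed sets is closed. *)
Lemma closed_unitary_group S : closed (unitary_group (commutant S)).
Proof.
have -> : unitary_group (commutant S) =
    (\bigcap_(ij in [set: 'I_d * 'I_d])
       [set U : M | (U *m U ^t*) ij.1 ij.2 - (1%:M : M) ij.1 ij.2 = 0]) `&`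
    (\bigcap_(Yij in S `*` [set: 'I_d * 'I_d])
       [set U : M | (U *m Yij.1) Yij.2.1 Yij.2.2 - (Yij.1 *m U) Yij.2.1 Yij.2.2 = 0]).
  apply/seteqP; split=> U /= [].
    move=> /unitarymxP UU cU; split=> [[i j] _ /=|[Y [i j]] [SY _] /=].
      by rewrite UU subrr.
    by rewrite cU// subrr.
  move=> uU cU; split=> [|Y SY].
    by apply/unitarymxP/matrixP => i j; apply/eqP; rewrite -subr_eq0 (uU (i, j)).
  apply/matrixP => i j; apply/eqP.
  by rewrite -subr_eq0 (cU (Y, (i, j))).
apply: closedI; apply: closed_bigI => -[]; last first.
  move=> Y [i j] _ /=; apply: closed_zeros.
  apply: continuous_funCB; first exact: continuous_mulmxr_entry.
  exact: continuous_mulmx_entry.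
move=> i j _ /=; apply: closed_zeros; apply: continuous_funCB.
  under eq_fun do rewrite mxE; apply: continuous_funC_sum => k.
  apply: continuous_funCM; first exact: continuous_entry.
  under eq_fun do rewrite !mxE.
  by apply: continuous_funC_conj; exact: continuous_entry.
exact: continuous_funC_cst.
Qed.

Lemma measurable_unitary_group S :
  measurable (unitary_group (commutant S) : set (borel_matrix R d)).
Proof. by apply: measurable_closed_borel; exact: closed_unitary_group. Qed.

(** Each row has norm 1. This is the source of every boundedness claim on the group. *)
Lemma unitary_entry_le1 U i j : U \is unitarymx -> `|U i j| <= 1.
Proof.
move=> /unitarymxP /matrixP /(_ i i); rewrite !mxE eqxx mulr1n => U1.
rewrite -(@expr_le1 _ 2)// -U1 (bigD1 j)//= !mxE.
rewrite normCK lerDl; apply: sumr_ge0 => k _; rewrite !mxE.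
exact: mul_conjC_ge0.
Qed.

(** The adjoint of a unitary is its inverse, and an inverse commutes with whatever the matrix
    commutes with. *)
Lemma unitary_group_inv S W : unitary_group (commutant S) W ->
  unitary_group (commutant S) (W ^t*).
Proof.
move=> [uW cW]; split; first by rewrite /= trmxC_unitary.
move=> Y /cW WY; have /unitarymxP WW := uW; have WW' := unitary_conjtr uW.
by rewrite -[RHS]mul1mx -WW' -!mulmxA [W *m _]mulmxA WY -mulmxA WW mulmx1.
Qed.

Lemma unitary_group_mul S U V : unitary_group (commutant S) U ->
  unitary_group (commutant S) V -> unitary_group (commutant S) (U *m V).
Proof.
move=> [uU cU] [uV cV]; split; first exact: mul_unitarymx.
by move=> Y SY; rewrite -mulmxA cV// !mulmxA cU.
Qed.

Variables (S : set M) (mu : probability (borel_matrix R d) R).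
Local Notation G := (unitary_group (commutant S)).
Hypothesis mu_haar : normalized_haar G mu.

(** The preimage of a set under multiplication by [W] is its image under multiplication by the
    adjoint, so invariance of sets says that the pushforward of [mu] is [mu]; the claim is then a
    change of variables for real and imaginary parts. *)
Lemma haar_invariant W f : G W -> bounded_mfun (G : set (borel_matrix R d)) f ->
  cintegral mu G (fun U => f (W *m U)) = cintegral mu G f.
Proof.
move=> GW bf; have mG := measurable_unitary_group S.
have [_ invmu] := mu_haar; have GW' := unitary_group_inv GW.
have [uW _] := GW; have /unitarymxP WW := uW; have WW' := unitary_conjtr uW.
pose phi (X : borel_matrix R d) : borel_matrix R d := W *m X.
have mphi : measurable_fun setT phi by exact: measurable_mulmx.
have phiE (B : set (borel_matrix R d)) :
    phi @^-1` B = [set W ^t* *m V | V in B].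
  apply/seteqP; split=> [X BX|_ [V BV <-]] /=.
    by exists (W *m X) => //; rewrite mulmxA WW' mul1mx.
  by rewrite /phi mulmxA WW mul1mx.
have phiG : phi @^-1` G = G.
  apply/seteqP; split=> U /= GU; last exact: unitary_group_mul.
  rewrite -(mul1mx U) -WW' -mulmxA; exact: unitary_group_mul.
have pushE (B : set (borel_matrix R d)) : measurable B ->
    pushforward mu phi B = mu B.
  by move=> mB; rewrite /pushforward phiE; exact: invmu.
have key (h : borel_matrix R d -> R) : measurable_fun setT h ->
    (forall U, G U -> `|h U|%:C <= `|f U|) ->
    \int[mu]_(U in G) h (phi U) = \int[mu]_(U in G) h U.
  move=> mh hf; rewrite /Rintegral; congr fine.
  transitivity (\int[pushforward mu phi]_(U in G) (h U)%:E)%E; last first.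
    by apply: eq_measure_integral => B mB _; exact: pushE.
  have [_ _ [K fK]] := bf.
  rewrite integral_pushforward//.
  - by rewrite phiG.
  - exact/measurable_EFinP.
  - rewrite phiG; apply: measurable_bounded_integrable => //.
    + exact: le_lt_trans (probability_le1 mu mG) (ltry _).
    + apply: (@measurable_funS _ _ _ _ setT) => //.
      exact: measurableT_comp.
    + exists K; split; first exact: num_real.
      move=> L KL U GU /=; apply: le_trans (ltW KL); rewrite -lecR.
      have GWU : G (phi U) by exact: unitary_group_mul.
      exact: le_trans (hf _ GWU) (fK _ GWU).
have [rf jf _] := bf.
congr (_ +i* _).
  by apply: (key _ rf) => U _; exact: normc_ge_Re.
by apply: (key _ jf) => U _; exact: normc_ge_Im.
Qed.

End unitary_group.

(** * Moments of Haar measure on block unitaries *)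

Lemma sum4_distr (K : pzRingType) (I1 I2 I3 I4 : Type) r1 r2 r3 r4
    (F : I1 -> K) (G : I2 -> K) (H : I3 -> K) (L : I4 -> K) :
  (\sum_(i <- r1) F i) * (\sum_(j <- r2) G j) *
  ((\sum_(k <- r3) H k) * (\sum_(l <- r4) L l)) =
  \sum_(i <- r1) \sum_(j <- r2) \sum_(k <- r3) \sum_(l <- r4)
    F i * G j * (H k * L l).
Proof.
rewrite [X in X * _]big_distrlr [X in _ * X]big_distrlr /= mulr_suml.
apply: eq_bigr => i _; rewrite mulr_suml; apply: eq_bigr => j _.
rewrite mulr_sumr; apply: eq_bigr => k _.
by rewrite mulr_sumr.
Qed.

Section moments.
Variables (R : realType) (d : nat) (I : finType) (blk : 'I_d -> I).
Local Notation C := (complex R).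
Local Notation M := 'M[C]_d.

(** The algebra is described by a labelling [blk] of plain indices instead of a block matrix, so
    that moments can be indexed by ['I_d] and membership in a block is an equality of labels.
    [block_scalarsE] makes the link. *)
Definition block_scalars : set M :=
  range (fun c : I -> C => diag_mx (\row_j c (blk j))).

(** Commutation with the projection onto the block of [j] already forces the entries that leave this
    block to vanish. *)
Lemma commutant_block_scalarsP X : commutant block_scalars X <->
  forall i j, blk i != blk j -> X i j = 0.
Proof.
split=> [XA i j ij|X0 Y [c _ <-]].
  have /matrixP/(_ i j) := XA _ (imageT _ (fun k => (k == blk j)%:R : C)).
  rewrite mul_mx_diag mul_diag_mx !mxE eqxx (negbTE ij) mulr1 mul0r.
  by [].
apply/matrixP => i j; rewrite mul_mx_diag mul_diag_mx !mxE.
by have [->|/X0 ->] := eqVneq (blk i) (blk j); rewrite ?mulr0 ?mul0r// mulrC.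
Qed.

Local Notation G := (unitary_group (commutant block_scalars)).

(** The complex reflection 1 + z |v><v|. Phases, transpositions and the reflection of
    [moment4_reflection] are all of this form, so unitarity and commutation are checked only
    once. *)
Definition reflection (z : C) (v : 'I_d -> C) : M :=
  \matrix_(i, j) ((i == j)%:R + z * v i * (v j)^*).

(** The product of 1 + z |v><v| and its adjoint differs from 1 by a multiple of |v><v|, whose
    coefficient is the first hypothesis; the second one says that [v] lives in a single block. *)
Lemma reflection_unitary_group z v :
  z * z^* * (\sum_i v i * (v i)^*) + z + z^* = 0 ->
  (forall i j, blk i != blk j -> v i * (v j)^* = 0) -> G (reflection z v).
Proof.
move=> zv vblk; split; last first.
  apply/commutant_block_scalarsP => i j ij; rewrite mxE.
  by rewrite (negbTE (contra_neq _ ij)) ?add0r -?mulrA ?vblk ?mulr0// => ->.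
apply/unitarymxP/matrixP => i j; rewrite !mxE.
transitivity (\sum_k ((i == k)%:R * (j == k)%:R +
    (z^* * (v j)^* * (v k * (i == k)%:R) + z * v i * ((v k)^* * (j == k)%:R)
    + z * z^* * v i * (v j)^* * (v k * (v k)^*)))).
  apply: eq_bigr => k _; rewrite !mxE rmorphD !rmorphM /= conjCK rmorph_nat.
  rewrite [i == k]eq_sym [j == k]eq_sym.
  move: (k == i)%:R (k == j)%:R (z^*) ((v j)^*) ((v k)^*) (v i) (v k) => a b c e f g h.
  ring.
have sumd (F : 'I_d -> C) x : \sum_k F k * (x == k)%:R = F x.
  rewrite (bigD1 x)//= eqxx mulr1 big1 ?addr0// => k kx.
  by rewrite eq_sym (negbTE kx) mulr0.
rewrite big_split /= (sumd (fun k => (i == k)%:R)) !big_split /= -!mulr_sumr.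
rewrite !sumd -[RHS]addr0; congr (_ + _).
rewrite -[RHS](mulr0 (v i * (v j)^*)) -[X in _ = _ * X]zv.
move: (\sum_k _) => S; move: (z^*) ((v j)^*) => a b; ring.
Qed.


Variable mu : probability (borel_matrix R d) R.
Hypothesis mu_haar : normalized_haar G mu.

Local Notation E := (cintegral mu G).

(** An entry of the projection onto the i-th column of [U]. As [Delta] keeps only the diagonal,
    [beta] involves no other products of entries. *)
Definition entry_prod (a b i : 'I_d) (U : M) : C := U a i * (U b i)^*.

Definition moment2 a b i : C := E (entry_prod a b i).

Definition moment4 a b i c e j : C :=
  E (fun U => entry_prod a b i U * entry_prod c e j U).

Let mG : measurable (G : set (borel_matrix R d)).
Proof. exact: measurable_unitary_group. Qed.

Let finG : (mu G < +oo)%E.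
Proof. exact: le_lt_trans (probability_le1 mu mG) (ltry _). Qed.

Lemma bounded_mfun_entry a i :
  bounded_mfun (G : set (borel_matrix R d)) (fun U : M => U a i).
Proof.
apply: continuous_bounded_mfun; first exact: continuous_entry.
by exists 1 => U [uU _]; exact: unitary_entry_le1.
Qed.

Lemma bounded_mfun_entry_prod a b i :
  bounded_mfun (G : set (borel_matrix R d)) (entry_prod a b i).
Proof.
apply: bounded_mfunM; first exact: bounded_mfun_entry.
by apply: bounded_mfun_conj; exact: bounded_mfun_entry.
Qed.

Lemma bounded_mfun_entry_prod2 a b i c e j :
  bounded_mfun (G : set (borel_matrix R d))
    (fun U => entry_prod a b i U * entry_prod c e j U).
Proof. by apply: bounded_mfunM; exact: bounded_mfun_entry_prod. Qed.

(** Expansion of the four entries of [W *m U]. The sums are nested so that a row of [W] with few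
    nonzero entries can be evaluated one index at a time. *)
Lemma moment4_equivariance W a b i c e j : G W ->
  moment4 a b i c e j =
  \sum_a' W a a' * (\sum_b' (W b b')^* * (\sum_c' W c c' * (\sum_e' (W e e')^* *
    moment4 a' b' i c' e' j))).
Proof.
move=> GW; transitivity (\sum_a' \sum_b' \sum_c' \sum_e'
    W a a' * (W b b')^* * (W c c' * (W e e')^*) * moment4 a' b' i c' e' j); last first.
  apply: eq_bigr => a' _; rewrite mulr_sumr; apply: eq_bigr => b' _.
  rewrite !mulr_sumr; apply: eq_bigr => c' _; rewrite !mulr_sumr.
  by apply: eq_bigr => e' _; rewrite !mulrA.
rewrite /moment4 -(haar_invariant mu_haar GW); last first.
  exact: bounded_mfun_entry_prod2.
have bM k a' b' c' e' :
    bounded_mfun (G : set (borel_matrix R d))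
    (fun U => k * (entry_prod a' b' i U * entry_prod c' e' j U)).
  by apply: bounded_mfunM; [exact: bounded_mfun_cst|exact: bounded_mfun_entry_prod2].
transitivity (E (fun U => \sum_a' \sum_b' \sum_c' \sum_e'
    W a a' * (W b b')^* * (W c c' * (W e e')^*) *
    (entry_prod a' b' i U * entry_prod c' e' j U))).
  apply: eq_cintegral => U _; rewrite /entry_prod !mxE !rmorph_sum sum4_distr.
  apply: eq_bigr => a' _; apply: eq_bigr => b' _.
  apply: eq_bigr => c' _; apply: eq_bigr => e' _.
  by rewrite !rmorphM /=; ring.
rewrite cintegral_sum// => [|a']; last first.
  by do 3! apply: bounded_mfun_sum => ?; exact: bM.
apply: eq_bigr => a' _; rewrite cintegral_sum// => [|b']; last first.
  by do 2! apply: bounded_mfun_sum => ?; exact: bM.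
apply: eq_bigr => b' _; rewrite cintegral_sum// => [|c']; last first.
  by apply: bounded_mfun_sum => ?; exact: bM.
apply: eq_bigr => c' _; rewrite cintegral_sum//.
by apply: eq_bigr => e' _; rewrite cintegralZl//; exact: bounded_mfun_entry_prod2.
Qed.

End moments.

(** * Second and fourth moments: the Weingarten formula on block unitaries *)

Section haar_moments.
Variables (R : realType) (d : nat) (I : finType) (blk : 'I_d -> I).
Local Notation C := (complex R).
Local Notation M := 'M[C]_d.
Local Notation G := (unitary_group (commutant (block_scalars (R := R) blk))).
Variable mu : probability (borel_matrix R d) R.
Hypothesis mu_haar : normalized_haar G mu.
Local Notation E := (cintegral mu G).
Local Notation moment2 := (moment2 blk mu).
Local Notation moment4 := (moment4 blk mu).

Let mG : measurable (G : set (borel_matrix R d)).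
Proof. exact: measurable_unitary_group. Qed.

Let finG : (mu G < +oo)%E.
Proof. exact: le_lt_trans (probability_le1 mu mG) (ltry _). Qed.

Lemma block_entry0 (U : M) a i : G U -> blk a != blk i -> U a i = 0.
Proof. by move=> [_ /commutant_block_scalarsP]; apply. Qed.

Lemma block_col_orthonormal (U : M) i j : G U ->
  \sum_a (U a i)^* * U a j = (i == j)%:R.
Proof.
move=> [/unitary_conjtr/matrixP/(_ i j) + _]; rewrite !mxE => <-.
by apply: eq_bigr => a _; rewrite !mxE.
Qed.

(** For a monomial matrix every row of [W *m U] is a multiple of one row of [U], so invariance
    relates single moments instead of sums. *)
Lemma moment2_monomial (w : 'I_d -> C) (s : 'I_d -> 'I_d) W a b i : G W ->
  (forall k k', W k k' = w k * (k' == s k)%:R) ->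
  moment2 a b i = w a * (w b)^* * moment2 (s a) (s b) i.
Proof.
move=> GW WE; rewrite /moment2 -(haar_invariant mu_haar GW); last first.
  exact: bounded_mfun_entry_prod.
rewrite -cintegralZl//; last exact: bounded_mfun_entry_prod.
have rowE (U : M) k l : (W *m U) k l = w k * U (s k) l.
  rewrite mxE (bigD1 (s k))//= big1 ?addr0 ?WE ?eqxx ?mulr1// => k' kk'.
  by rewrite WE (negbTE kk') mulr0 mul0r.
by apply: eq_cintegral => U _; rewrite /entry_prod !rowE rmorphM /= mulrACA.
Qed.

Lemma moment4_monomial (w : 'I_d -> C) (s : 'I_d -> 'I_d) W a b i c e j : G W ->
  (forall k k', W k k' = w k * (k' == s k)%:R) ->
  moment4 a b i c e j = w a * (w b)^* * (w c * (w e)^*) *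
    moment4 (s a) (s b) i (s c) (s e) j.
Proof.
move=> GW WE; rewrite /moment4 -(haar_invariant mu_haar GW); last first.
  exact: bounded_mfun_entry_prod2.
rewrite -cintegralZl//; last exact: bounded_mfun_entry_prod2.
have rowE (U : M) k l : (W *m U) k l = w k * U (s k) l.
  rewrite mxE (bigD1 (s k))//= big1 ?addr0 ?WE ?eqxx ?mulr1// => k' kk'.
  by rewrite WE (negbTE kk') mulr0 mul0r.
apply: eq_cintegral => U _; rewrite /entry_prod !rowE !rmorphM /=; ring.
Qed.

(** A sign would not suffice: a row that occurs twice, both times unconjugated, is detected only
    because the square of the phase differs from 1. *)
Definition phase (x k : 'I_d) : C := if k == x then 'i else 1.

Lemma phase_matrix x : exists2 W, G W &
  forall k k', W k k' = phase x k * (k' == k)%:R.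
Proof.
(* On the axis [e_x] the diagonal entry becomes 1 + ('i - 1) = 'i. *)
exists (reflection ('i - 1) (fun k => (k == x)%:R)).
  apply: reflection_unitary_group => [|a b ab].
    rewrite (bigD1 x)//= big1 => [|k /negbTE->]; last by rewrite mul0r.
    rewrite eqxx rmorphB /= conjCi rmorph1.
    have := sqrCi C; rewrite expr2 => i2.
    rewrite (_ : _ + _ = - ('i * 'i) - 1); first by rewrite i2 opprK subrr.
    by ring.
  have [ax|_] := eqVneq a x; last by rewrite mul0r.
  have [bx|_] := eqVneq b x; last by rewrite rmorph0 mulr0.
  by rewrite ax bx eqxx in ab.
move=> k k'; rewrite mxE /phase [k' == k]eq_sym rmorph_nat.
have [->|kx] := eqVneq k x; last by rewrite !(mulr0, mul0r, addr0, mul1r).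
have [_|_] := eqVneq k' x; first by rewrite !mulr1 addrCA subrr addr0.
by rewrite !mulr0 addr0.
Qed.

(** The reflection 1 - |v><v| with v = e_x - e_y, of squared norm 2, exchanges the two basis
    vectors; equality of labels keeps it in the group. For x = y the vector degenerates and the
    identity is used. *)
Lemma swap_matrix x y : blk x = blk y -> exists2 W, G W &
  forall k k', W k k' = 1 * (k' == tperm x y k)%:R.
Proof.
move=> xy; have [->|nxy] := eqVneq x y.
  exists (reflection 0 (fun=> 0)) => [|k k'].
    by apply: reflection_unitary_group => [|? ? _]; rewrite ?rmorph0 !(mul0r, addr0).
  by rewrite mxE !mul0r addr0 mul1r tperm1 perm1 eq_sym.
pose v (k : 'I_d) : C := (k == x)%:R - (k == y)%:R.
have v0 k : k != x -> k != y -> v k = 0.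
  by move=> /negbTE kx /negbTE ky; rewrite /v kx ky subrr.
have vx : v x = 1 by rewrite /v eqxx (negbTE nxy) subr0.
have vy : v y = -1 by rewrite /v eqxx eq_sym (negbTE nxy) add0r.
exists (reflection (-1) v).
  apply: reflection_unitary_group => [|a b ab].
    rewrite (bigD1 x)//= (bigD1 y) 1?eq_sym//= big1 => [|k /andP[kx ky]]; last first.
      by rewrite v0 ?mul0r.
    by rewrite vx vy !rmorphN !rmorph1; ring.
  have vb k : v k != 0 -> blk k = blk x.
    by move=> vk; have [->//|kx] := eqVneq k x; have [->|ky] := eqVneq k y;
      rewrite // v0 ?eqxx in vk.
  have [->|/vb ax] := eqVneq (v a) 0; first by rewrite mul0r.
  have [->|/vb bx] := eqVneq (v b) 0; first by rewrite rmorph0 mulr0.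
  by rewrite ax bx eqxx in ab.
move=> k k'; rewrite mxE mul1r.
case: tpermP => [->|->|/eqP kx /eqP ky].
- rewrite vx mulr1 rmorphB !rmorph_nat [x == k']eq_sym; ring.
- rewrite vy rmorphB !rmorph_nat [y == k']eq_sym; ring.
- by rewrite v0// mulr0 mul0r addr0 eq_sym.
Qed.

Lemma moment2_phase x a b i :
  moment2 a b i = phase x a * (phase x b)^* * moment2 a b i.
Proof.
have [W GW WE] := phase_matrix x; exact: (moment2_monomial (s := id) a b i GW WE).
Qed.

Lemma moment4_phase x a b i c e j : moment4 a b i c e j =
  phase x a * (phase x b)^* * (phase x c * (phase x e)^*) * moment4 a b i c e j.
Proof.
have [W GW WE] := phase_matrix x; exact: (moment4_monomial (s := id) a b i c e j GW WE).
Qed.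

Lemma moment2_swap x y a b i : blk x = blk y ->
  moment2 a b i = moment2 (tperm x y a) (tperm x y b) i.
Proof.
move=> xy; have [W GW WE] := swap_matrix xy.
by rewrite (moment2_monomial a b i GW WE) rmorph1 !mul1r.
Qed.

Lemma moment4_swap x y a b i c e j : blk x = blk y -> moment4 a b i c e j =
  moment4 (tperm x y a) (tperm x y b) i (tperm x y c) (tperm x y e) j.
Proof.
move=> xy; have [W GW WE] := swap_matrix xy.
by rewrite (moment4_monomial a b i c e j GW WE) rmorph1 !mul1r.
Qed.

Let fixed0 (k z : C) : z = k * z -> k != 1 -> z = 0.
Proof.
move=> zk k1; apply/eqP; move/eqP: zk.
rewrite -subr_eq0 -{1}(mul1r z) -mulrBl mulf_eq0 subr_eq0 [1 == k]eq_sym.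
by rewrite (negbTE k1).
Qed.

Let i_neq1 : ('i : C) != 1.
Proof.
apply/eqP => i1; have /eqP := sqrCi C; rewrite i1 expr1n -subr_eq0 opprK.
by rewrite -mulr2n pnatr_eq0.
Qed.

Let N1_neq1 : (-1 : C) != 1.
Proof. by rewrite eq_sym -subr_eq0 opprK -mulr2n pnatr_eq0. Qed.

Lemma moment2_eq0 a b i : a != b -> moment2 a b i = 0.
Proof.
move=> ab; apply: (fixed0 (moment2_phase a a b i)).
by rewrite /phase eqxx [b == a]eq_sym (negbTE ab) rmorph1 mulr1 i_neq1.
Qed.

(** Unless [a], [c] and [b], [e] agree as multisets, some row occurs unequally often plain and
    conjugated; its phase multiplies the moment by 'i or -1, hence the moment is 0. *)
Lemma moment4_eq0 a b i c e j : ~~ ((a == b) && (c == e)) ->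
  ~~ ((a == e) && (c == b)) -> moment4 a b i c e j = 0.
Proof.
have ii : 'i * 'i = -1 :> C by rewrite -expr2 sqrCi.
have [->|ab] := eqVneq a b => /=.
  move=> ce _; apply: (fixed0 (moment4_phase c b b i c e j)).
  rewrite /phase eqxx [e == c]eq_sym (negbTE ce) rmorph1 mulr1.
  have [_|_] := eqVneq b c; rewrite ?rmorph1 ?conjCi ?mul1r//.
  by rewrite mulrN ii opprK mul1r.
move=> _; have [->|ae] := eqVneq a e => /=.
  move=> cb; apply: (fixed0 (moment4_phase c e b i c e j)).
  rewrite /phase eqxx [b == c]eq_sym (negbTE cb) rmorph1 mulr1.
  have [_|_] := eqVneq e c; rewrite ?rmorph1 ?conjCi ?mul1r ?mulr1//.
  by rewrite mulrN ii opprK mulr1.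
move=> _; apply: (fixed0 (moment4_phase a a b i c e j)).
rewrite /phase eqxx [b == a]eq_sym [e == a]eq_sym (negbTE ab) (negbTE ae).
rewrite rmorph1 !mulr1.
by case: (c == a); rewrite ?ii ?mulr1 ?N1_neq1 ?i_neq1.
Qed.


Definition block_size (i : 'I_d) : C := #|[pred k | blk k == blk i]|%:R.

Lemma block_size_neq0 i : block_size i != 0.
Proof.
rewrite pnatr_eq0 -lt0n; apply/card_gt0P; exists i.
by rewrite inE eqxx.
Qed.

Lemma eq_block_size i j : blk i = blk j -> block_size i = block_size j.
Proof. by rewrite /block_size => ->. Qed.

Lemma sum_block_const (F : 'I_d -> C) i v :
  (forall k, blk k != blk i -> F k = 0) ->
  (forall k, blk k = blk i -> F k = v) -> \sum_k F k = block_size i * v.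
Proof.
move=> F0 Fv; rewrite (bigID [pred k | blk k == blk i])/= [X in _ + X]big1//.
rewrite addr0 (eq_bigr (fun=> v)) => [|k /eqP/Fv//].
by rewrite sumr_const mulr_natl.
Qed.

Lemma cintegral_group0 (f : M -> C) : (forall U, G U -> f U = 0) -> E f = 0.
Proof.
move=> f0; rewrite (_ : E f = E (fun=> 0)); last exact: eq_cintegral.
by rewrite cintegral_cst//; case: mu_haar.
Qed.

Lemma moment2_support a b i :
  ~~ ((blk a == blk i) && (blk b == blk i)) -> moment2 a b i = 0.
Proof.
rewrite negb_and => ab; apply: cintegral_group0 => U GU; rewrite /entry_prod.
by case/orP: ab => /(block_entry0 GU) ->; rewrite ?rmorph0 ?mul0r ?mulr0.
Qed.

Lemma moment4_support a b i c e j :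
  ~~ [&& blk a == blk i, blk b == blk i, blk c == blk j & blk e == blk j] ->
  moment4 a b i c e j = 0.
Proof.
rewrite !negb_and => abce; apply: cintegral_group0 => U GU; rewrite /entry_prod.
by case/or4P: abce => /(block_entry0 GU) ->; rewrite ?rmorph0 ?(mul0r, mulr0).
Qed.

Lemma sum_moment2 i : \sum_a moment2 a a i = 1.
Proof.
have E1 : E (fun=> 1) = 1 by apply: cintegral_cst => //; case: mu_haar.
rewrite -[RHS]E1 -cintegral_sum// => [|a]; last exact: bounded_mfun_entry_prod.
apply: eq_cintegral => U GU /=; have := block_col_orthonormal i i GU.
rewrite eqxx /= => U1; apply: etrans U1.
by apply: eq_bigr => a _; rewrite /entry_prod mulrC.
Qed.

(** Transpositions make the diagonal moments of a block equal, and normalization of the column makes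
    them sum to 1. *)
Lemma moment2E a b i :
  moment2 a b i = ((a == b) && (blk a == blk i))%:R / block_size i.
Proof.
have [<-|/moment2_eq0->] := eqVneq a b; last by rewrite mul0r.
have [ai|ai] := eqVneq (blk a) (blk i); last first.
  by rewrite mul0r moment2_support// (negbTE ai).
apply: (mulfI (block_size_neq0 i)); rewrite mul1r divff ?block_size_neq0//.
rewrite -(sum_moment2 i); apply/esym/sum_block_const => k ki.
  by rewrite moment2_support// (negbTE ki).
by rewrite (moment2_swap k k i (x := k) (y := a)) ?tpermL// ki.
Qed.

Lemma sum_moment4_diag a b i j : \sum_c moment4 a b i c c j = moment2 a b i.
Proof.
rewrite /moment4 -cintegral_sum// => [|c]; last exact: bounded_mfun_entry_prod2.
apply: eq_cintegral => U GU; rewrite -mulr_sumr.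
have := block_col_orthonormal j j GU; rewrite eqxx /= => U1.
rewrite (_ : \sum_c _ = 1) ?mulr1//; apply: etrans U1.
by apply: eq_bigr => c _; rewrite /entry_prod mulrC.
Qed.

(** The sum over [b] is the scalar product of columns [i] and [j]; this is where the Kronecker delta
    of the columns enters the Weingarten coefficients. *)
Lemma sum_moment4_antidiag a i j :
  \sum_b moment4 a b i b a j = (i == j)%:R * moment2 a a i.
Proof.
rewrite /moment4 -cintegral_sum// => [|b]; last exact: bounded_mfun_entry_prod2.
rewrite -cintegralZl//; last exact: bounded_mfun_entry_prod.
apply: eq_cintegral => U GU; rewrite /entry_prod.
transitivity (U a i * (U a j)^* * \sum_b (U b i)^* * U b j).
  by rewrite mulr_sumr; apply: eq_bigr => b _; ring.
rewrite (block_col_orthonormal i j GU).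
by have [->|_] := eqVneq i j; rewrite ?mulr0 ?mul0r// mulrC.
Qed.

(* Invariance under the reflection sending e_a to (3 e_a + 4 e_c) / 5; together
   with phases and transpositions it determines the fourth moments. *)
Lemma moment4_reflection a c i j : a != c -> blk a = blk c ->
  moment4 a a i a a j = moment4 a a i c c j + moment4 a c i c a j.
Proof.
move=> ac bac.
(* The squared norm of [v] is 5 and the factor is -2/5, a Householder reflection. The triple 3, 4, 5
   keeps all its entries rational. *)
pose v (k : 'I_d) : C := 2 * (k == c)%:R - (k == a)%:R.
have va : v a = -1 by rewrite /v eqxx (negbTE ac) mulr0 add0r.
have vc : v c = 2 by rewrite /v eqxx eq_sym (negbTE ac) mulr1 subr0.
have v0 k : k != a -> k != c -> v k = 0.
  by move=> /negbTE ka /negbTE kc; rewrite /v ka kc mulr0 subrr.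
have conj2 : (2 : C)^* = 2 by rewrite rmorph_nat.
have conjz : (- 2 / 5 : C)^* = - 2 / 5.
  by rewrite rmorphM rmorphN fmorphV !rmorph_nat.
have [W WE GW] : exists2 W, W = reflection (- 2 / 5) v & G W.
  exists (reflection (- 2 / 5) v) => //.
  apply: reflection_unitary_group => [|k l kl].
    rewrite conjz (bigD1 a)//= (bigD1 c) 1?eq_sym//= big1
      => [|k /andP[ka kc]]; last first.
      by rewrite v0 ?mul0r.
    by rewrite va vc rmorphN rmorph1 conj2; field.
  have vb k' : v k' != 0 -> blk k' = blk a.
    by move=> vk; have [->//|ka] := eqVneq k' a; have [->|kc] := eqVneq k' c;
      rewrite // v0 ?eqxx in vk.
  have [->|/vb ka] := eqVneq (v k) 0; first by rewrite mul0r.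
  have [->|/vb la] := eqVneq (v l) 0; first by rewrite rmorph0 mulr0.
  by rewrite ka la eqxx in kl.
have Waa : W a a = 3 / 5.
  by rewrite WE mxE eqxx va rmorphN rmorph1; field.
have Wac : W a c = 4 / 5.
  by rewrite WE mxE (negbTE ac) va vc conj2 mulr0n; field.
have Wa0 k : k != a -> k != c -> W a k = 0.
  by move=> ka kc; rewrite WE mxE (v0 k)// rmorph0 mulr0 eq_sym (negbTE ka) addr0.
have row (F : 'I_d -> C) : \sum_k W a k * F k = 3 / 5 * F a + 4 / 5 * F c.
  rewrite (bigD1 a)//= (bigD1 c) 1?eq_sym//= big1
      => [|k /andP[ka kc]]; last first.
    by rewrite Wa0 ?mul0r.
  by rewrite Waa Wac addr0.
have rowC (F : 'I_d -> C) : \sum_k (W a k)^* * F k = 3 / 5 * F a + 4 / 5 * F c.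
  rewrite (bigD1 a)//= (bigD1 c) 1?eq_sym//= big1
      => [|k /andP[ka kc]]; last first.
    by rewrite Wa0 ?rmorph0 ?mul0r.
  by rewrite Waa Wac addr0 !rmorphM !fmorphV !rmorph_nat.
have swap b1 b2 b3 b4 : moment4 b1 b2 i b3 b4 j =
    moment4 (tperm a c b1) (tperm a c b2) i (tperm a c b3) (tperm a c b4) j.
  exact: moment4_swap.
have := moment4_equivariance mu_haar a a i a a j GW.
rewrite row !rowC !row !rowC.
have ca : c == a = false by rewrite eq_sym (negbTE ac).
have z b1 b2 b3 b4 : ~~ ((b1 == b2) && (b3 == b4)) ->
    ~~ ((b1 == b4) && (b3 == b2)) -> moment4 b1 b2 i b3 b4 j = 0.
  exact: moment4_eq0.
rewrite (z a a a c) ?(z a a c a) ?(z a c a a) ?(z c a a a) ?(z c c c a);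
  rewrite ?(z c c a c) ?(z c a c c) ?(z a c c c) ?(z a c a c) ?(z c a c a);
  rewrite ?eqxx ?(negbTE ac) ?ca//.
rewrite (swap c c c c) (swap c c a a) (swap c a a c) tpermL tpermR.
move: (moment4 a a i a a j) (moment4 a a i c c j) (moment4 a c i c a j) => s p q.
move=> spq; apply/eqP; rewrite -subr_eq0.
(* Each of p and q collects two terms of weight (3/5)^2 (4/5)^2, that is 288/625 in all, and s keeps
   (3/5)^4 + (4/5)^4 = 1 - 288/625. *)
have : (288 / 625) * (s - (p + q)) = 0.
  by have := subrr s; rewrite {2}spq => <-; field.
by move/eqP; rewrite mulf_eq0 => /orP[|//]; rewrite mulf_eq0 invr_eq0 !pnatr_eq0.
Qed.

(* In a block of size 1 the division by zero yields q = 0, which is the right value. *)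
Definition weingarten_q (i j : 'I_d) : C :=
  if blk i == blk j
  then ((i == j)%:R - (block_size i)^-1) / (block_size i ^+ 2 - 1) else 0.

(** Solved from p n_j + q = 1 / n_i, the sum of the fourth moments over the rows of column [j]. For
    distinct blocks q = 0 and p = 1 / (n_i n_j). *)
Definition weingarten_p (i j : 'I_d) : C :=
  ((block_size i)^-1 - weingarten_q i j) / block_size j.

Lemma moment4_block_values i j a c : blk i = blk j -> blk a = blk i ->
  blk c = blk i -> a != c ->
  [/\ moment4 a a i c c j = weingarten_p i j,
      moment4 a c i c a j = weingarten_q i j &
      moment4 a a i a a j = weingarten_p i j + weingarten_q i j].
Proof.
move=> ij ai ci ac.
have nE : block_size i = 1 + \sum_(k | (blk k == blk i) && (k != a)) 1.
  rewrite sumr_const -mulrS /block_size; congr _%:R.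
  by rewrite [LHS](cardD1 a) inE ai eqxx add1n; congr _.+1; apply: eq_card => k;
    rewrite !inE andbC.
have sumE (F : 'I_d -> C) v : (forall k, blk k != blk i -> F k = 0) ->
    (forall k, blk k = blk i -> k != a -> F k = v) ->
    \sum_k F k = F a + (block_size i - 1) * v.
  move=> F0 Fv; rewrite (bigD1 a)//=; congr (_ + _).
  rewrite (bigID [pred k | blk k == blk i])/= [X in _ + X]big1 ?addr0; last first.
    by move=> k /andP[_ /F0].
  rewrite nE addrC addKr mulr_suml; apply: eq_big => [k|k].
    by rewrite andbC.
  by move=> /andP[ka /eqP ki]; rewrite mul1r Fv.
have tk k : k != a -> tperm c k a = a.
  by move=> ka; rewrite tpermD// eq_sym.
have Ha : moment2 a a i = (block_size i)^-1 by rewrite moment2E eqxx ai eqxx mul1r.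
have := sum_moment4_diag a a i j; rewrite (sumE _ (moment4 a a i c c j)); first last.
- move=> k ki ka; rewrite (@moment4_swap c k) ?ci ?ki//.
  by rewrite tk// tpermR.
- by move=> k ki; rewrite moment4_support// -ij (negbTE ki) !andbF.
have := sum_moment4_antidiag a i j; rewrite (sumE _ (moment4 a c i c a j)); first last.
- move=> k ki ka; rewrite (@moment4_swap c k) ?ci ?ki//.
  by rewrite tk// tpermR.
- by move=> k ki; rewrite moment4_support// (negbTE ki) !andbF.
rewrite Ha (moment4_reflection i j ac) ?ai ?ci//.
rewrite /weingarten_p /weingarten_q ij eqxx -(eq_block_size ij).
have n1 : block_size i ^+ 2 - 1 != 0.
  rewrite (_ : _ - 1 = (block_size i - 1) * (block_size i + 1)); last by ring.
  rewrite mulf_neq0// /block_size ?natr1 ?pnatr_eq0//.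
  move: nE; rewrite /block_size => ->.
  rewrite addrC addKr sumr_const pnatr_eq0 -lt0n.
  by apply/card_gt0P; exists c; rewrite unfold_in /= ci eqxx eq_sym.
have n0 := block_size_neq0 i.
move: (moment4 a a i c c j) (moment4 a c i c a j) ((i == j)%:R : C) => p q del.
move: (block_size i) n0 n1 => n n0 n1 Hq Hp.
have qE : q = (del - n^-1) / (n ^+ 2 - 1).
  apply: (mulIf n1); rewrite divfK//.
  transitivity (n * (p + q + (n - 1) * q) - (p + q + (n - 1) * p)); first by ring.
  by rewrite Hq Hp mulrCA divff// mulr1.
have pE : p = (n^-1 - (del - n^-1) / (n ^+ 2 - 1)) / n.
  apply: (mulIf n0); rewrite divfK// -qE -Hp; ring.
by split; rewrite // {1}pE {1}qE.
Qed.

Lemma moment4E a b i c e j : moment4 a b i c e j =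
  [&& blk a == blk i, blk b == blk i, blk c == blk j & blk e == blk j]%:R *
  (weingarten_p i j * ((a == b) && (c == e))%:R +
   weingarten_q i j * ((a == e) && (c == b))%:R).
Proof.
have [/and4P[/eqP ai /eqP bi /eqP cj /eqP ej]|nsup] := boolP [&& _, _, _ & _];
  last by rewrite mul0r moment4_support.
rewrite mul1r.
(* In distinct blocks the rows [a] and [e] differ, only the p pairing survives, and transpositions
   inside the block of [j] do not touch [a]. *)
have [ij|ij] := eqVneq (blk i) (blk j); last first.
  have q0 : weingarten_q i j = 0 by rewrite /weingarten_q (negbTE ij).
  rewrite q0 mul0r addr0 /weingarten_p q0 subr0.
  have ae : a != e by apply: contra_neq ij => ae; rewrite -ai ae.
  have [/andP[/eqP <- /eqP <-]|abce] := boolP ((a == b) && (c == e)); last first.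
    by rewrite mulr0 moment4_eq0// (negbTE ae).
  rewrite mulr1; apply: (mulIf (block_size_neq0 j)).
  rewrite divfK ?block_size_neq0// mulrC.
  rewrite -(sum_block_const (F := fun k => moment4 a a i k k j)).
  - by rewrite sum_moment4_diag moment2E eqxx ai eqxx mul1r.
  - by move=> k kj; rewrite moment4_support// (negbTE kj) !andbF.
  - move=> k kj; rewrite (@moment4_swap c k) ?cj// tpermR tpermD//.
      by apply: contra_neq ij => ca; rewrite -ai -ca.
    by apply: contra_neq ij => ka; rewrite -ai -ka.
have ci : blk c = blk i by rewrite cj.
have [abce|nab] := boolP ((a == b) && (c == e)); last first.
  have [/andP[/eqP ae /eqP cb]|ncb] := boolP ((a == e) && (c == b)); last first.
    by rewrite !mulr0 addr0 moment4_eq0.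
  have ac : a != c by apply: contraNneq nab => ac; rewrite -ae -cb ac !eqxx.
  have [_ qE _] := moment4_block_values ij ai ci ac.
  by rewrite -ae -cb qE mulr0 mulr1 add0r.
have /andP[/eqP <- /eqP <-] := abce.
have [<-|ac] := eqVneq a c; last first.
  have [-> _ _] := moment4_block_values ij ai ci ac.
  by rewrite mulr0 mulr1 addr0.
rewrite !mulr1.
(* A second row of the block brings the case back to the linear system; without one, n = 1 and the
   column sum has a single term, equal to 1. *)
have [k /andP[/eqP ki ka]|blka] := pickP [pred k | (blk k == blk i) && (a != k)].
  by have [_ _ ->] := moment4_block_values ij ai ki ka.
have only k : blk k = blk i -> k = a.
  by move=> ki; have := blka k; rewrite /= ki eqxx => /negbFE/eqP.
have n1 : block_size i = 1.
  rewrite /block_size -[1]/(1%:R); congr _%:R; rewrite -(card1 a).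
  by apply: eq_card => k; rewrite !inE; apply/eqP/eqP => [/only//|->].
have Hs : moment4 a a i a a j = 1.
  have := sum_moment4_diag a a i j; rewrite (bigD1 a)//= big1 ?addr0 => [->|k ka].
    by rewrite moment2E eqxx ai eqxx n1 divr1.
  rewrite moment4_support// -ij.
  by have [/only kE|_] := eqVneq (blk k) (blk i);
    [rewrite kE eqxx in ka|rewrite !andbF].
by rewrite Hs /weingarten_p -(eq_block_size ij) n1 invr1 mulr1 subrK.
Qed.

End haar_moments.

(** * Channels and their Choi forms *)

(** At z e_p + e_q the form equals Q q q plus a term [g z] homogeneous under nonnegative scaling and
    odd in z. Being bounded by Q q q, [g] is nonpositive, hence 0 by oddness; z = 1 and z = 'i then
    separate the two entries. *)
Lemma psd_form_row0 (R : rcfType) (P : finType) (Q : P -> P -> complex R) p q :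
  (forall x : P -> complex R, 0 <= \sum_s \sum_t (x s)^* * Q s t * x t) ->
  Q p p = 0 -> Q p q = 0 /\ Q q p = 0.
Proof.
move=> Qge0 Qpp; have [<-//|pq] := eqVneq p q.
have pqF : (p == q) = false by exact: negbTE.
have qpF : (q == p) = false by rewrite eq_sym.
pose g (z : complex R) := z^* * Q p q + z * Q q p.
have gq z : 0 <= g z + Q q q.
  have inner s : \sum_t (z *+ (s == p) + 1 *+ (s == q))^* * Q s t *
      (z *+ (t == p) + 1 *+ (t == q)) =
      (z *+ (s == p) + 1 *+ (s == q))^* * (Q s p * z + Q s q).
    rewrite (bigD1 p)//= (bigD1 q) ?qpF//= big1 ?addr0
      => [|t /andP[/negbTE tp /negbTE tq]].
      by rewrite ?eqxx ?pqF ?qpF !(mulr0n, mulr1n, addr0, add0r); ring.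
    by rewrite tp tq addr0 mulr0.
  have := Qge0 (fun s => z *+ (s == p) + 1 *+ (s == q)).
  rewrite (eq_bigr _ (fun s _ => inner s)) (bigD1 p)//= (bigD1 q) ?qpF//=.
  rewrite [X in _ + (_ + X)]big1 ?addr0
    => [|s /andP[/negbTE sp /negbTE sq]]; last first.
    by rewrite sp sq addr0 rmorph0 !mul0r.
  rewrite ?eqxx ?pqF ?qpF !(mulr0n, mulr1n, addr0, add0r).
  by rewrite Qpp rmorph1 mul0r add0r mul1r addrA [Q q p * z]mulrC.
have gN z : g (- z) = - g z by rewrite /g rmorphN !mulNr opprD.
have gZ s z : 0 <= s -> g (s * z) = s * g z.
  by move=> s0; rewrite /g rmorphM /= (geC0_conj s0) mulrDr !mulrA.
have Qqq : 0 <= Q q q by have := gq 0; rewrite /g rmorph0 !mul0r !add0r.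
have gle0 z : g z <= 0.
  have gQ w : g w <= Q q q.
    by have := gq (- w); rewrite gN addrC subr_ge0.
  have gr : g z \is Num.real by rewrite (ler_real (gQ z)) ger0_real.
  rewrite real_leNgt ?real0//; apply/negP => gz0.
  (* Scaling z by this factor would give [g] the value Q q q + 1, above its bound. *)
  have s0 : 0 <= (Q q q + 1) / g z.
    by apply: divr_ge0; [exact: addr_ge0|exact: ltW].
  have := gQ ((Q q q + 1) / g z * z); rewrite gZ// divfK ?gt_eqF//.
  by rewrite gerDl ler10.
have g0 z : g z = 0.
  by apply/le_anti; rewrite gle0 -oppr_le0 -gN gle0.
have := g0 1; have := g0 'i; rewrite /g conjCi rmorph1 !mul1r => gi g1.
have i0 : 'i != 0 :> complex R by exact: neq0Ci.
have qp : Q q p = Q p q.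
  by apply: (mulfI i0); apply/eqP; rewrite -subr_eq0 addrC -mulNr gi.
by move: g1; rewrite qp => /eqP; rewrite -mulr2n mulrn_eq0 => /eqP->.
Qed.

Section channels.
Variables (R : realType) (d : nat).
Local Notation C := (complex R).
Local Notation M := 'M[C]_d.

Lemma sig_pair_bij n : bijective (fun s : 'I_(\sum_(i < n) d) =>
  (tagnat.sig1 s, (tagnat.sig2 s : 'I_d))).
Proof.
exists (fun p : 'I_n * 'I_d => tagnat.Rank (p_ := fun=> d) p.1 p.2).
  by move=> s; rewrite /= tagnat.sig2K.
move=> [a k] /=; congr (_, _); first exact: tagnat.Rank1K.
by rewrite tagnat.Rank2K; apply: val_inj.
Qed.

(** Complete positivity with n = d, applied to the block matrix of all matrix units, the
    unnormalized maximally entangled projection. *)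
Lemma choi_form_ge0 (tau : M -> M) (x : 'I_d * 'I_d -> C) :
  completely_positive tau ->
  0 <= \sum_p \sum_q (x p)^* * tau (delta_mx p.1 q.1) p.2 q.2 * x q.
Proof.
move=> cp; pose pr (s : 'I_(\sum_(i < d) d)) : 'I_d * 'I_d :=
  (tagnat.sig1 s, tagnat.sig2 s).
have prb : {on [pred _ | true], bijective pr} by apply: onW_bij; exact: sig_pair_bij.
pose Z : 'M[C]_(\sum_(i < d) d) := \mxblock_(a < d, b < d) (delta_mx a b : M).
have mulE (y : 'cV[C]_(\sum_(i < d) d)) (B : 'M[C]_(\sum_(i < d) d)) :
    (y ^t* *m B *m y) 0 0 = \sum_s \sum_t (y s 0)^* * B s t * y t 0.
  rewrite mxE exchange_big /=; apply: eq_bigr => t _.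
  rewrite mxE mulr_suml; apply: eq_bigr => s _; by rewrite !mxE.
have psdZ : psd Z.
  move=> y; rewrite mulE.
  (* The pairing of [y] with the sum of the vectors e_a tensor e_a; the block matrix has rank one
     and its form is the squared modulus of [S]. *)
  pose S := \sum_s ((pr s).1 == (pr s).2)%:R * y s 0.
  rewrite (_ : \sum_s _ = S * S^*); first exact: mul_conjC_ge0.
  rewrite mulrC /S rmorph_sum mulr_suml; apply: eq_bigr => s _.
  rewrite mulr_sumr; apply: eq_bigr => t _.
  rewrite !mxE rmorphM rmorph_nat /pr /=.
  rewrite [tagnat.sig2 s == _]eq_sym [tagnat.sig2 t == _]eq_sym.
  by case: eqP => _; case: eqP => _ /=; rewrite !(mul1r, mul0r, mulr0, mulr1).
have := cp d Z psdZ (\col_s x (pr s)); rewrite mulE.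
rewrite [X in _ -> 0 <= X](reindex pr)//=.
rewrite (eq_bigr (fun s => \sum_q (x (pr s))^* *
  tau (delta_mx (pr s).1 q.1) (pr s).2 q.2 * x q))// => s _.
rewrite [RHS](reindex pr)//=; apply: eq_bigr => t _.
rewrite !mxE; congr (_ * _ * _).
by rewrite mxblockK.
Qed.

Lemma linear_matrix_sum (tau : M -> M) X : linear tau ->
  tau X = \sum_a \sum_b X a b *: tau (delta_mx a b).
Proof.
move=> lt; have tD u v : tau (u + v) = tau u + tau v.
  by have := lt 1 u v; rewrite !scale1r.
have t0 : tau 0 = 0.
  have /eqP := tD 0 0; rewrite addr0 -subr_eq0 opprD addNKr oppr_eq0.
  by move/eqP.
have tZ k u : tau (k *: u) = k *: tau u by have := lt k u 0; rewrite t0 !addr0.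
have tS (J : Type) (r : seq J) (F : J -> M) :
    tau (\sum_(j <- r) F j) = \sum_(j <- r) tau (F j).
  exact: (big_morph tau tD t0).
rewrite {1}(matrix_sum_delta X) tS; apply: eq_bigr => a _; rewrite tS.
by apply: eq_bigr => b _; rewrite tZ.
Qed.

End channels.

(** * Conditional expectation and channels in block coordinates *)

Section block_channels.
Variables (R : realType) (d : nat) (I : finType) (blk : 'I_d -> I).
Local Notation C := (complex R).
Local Notation M := 'M[C]_d.
Local Notation A := (block_scalars (R := R) blk).
Local Notation block_size := (block_size R blk).

Definition cond_exp_tensor (a b k l : 'I_d) : C :=
  [&& a == b, k == l & blk a == blk k]%:R / block_size k.

Lemma sum_in_block (F : 'I_d -> C) i : \sum_k F k * (blk k == blk i)%:R =
  \sum_(k | blk k == blk i) F k.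
Proof.
by rewrite [RHS]big_mkcond; apply: eq_bigr => k _; case: ifP; rewrite ?mulr1 ?mulr0.
Qed.

(** The block averages of the diagonal satisfy the defining orthogonality. Two candidates differ by
    an element of the algebra that is orthogonal to itself, hence zero, so [xget] selects this
    one. *)
Lemma cond_expE X k l :
  cond_exp A X k l = (k == l)%:R * (\sum_(a | blk a == blk k) X a a) / block_size k.
Proof.
pose mean (x : I) : C := (\sum_(a | blk a == x) X a a) / #|[pred a | blk a == x]|%:R.
pose X0 : M := diag_mx (\row_j mean (blk j)).
have AX0 : A X0 by exists mean.
have X0orth Y : A Y -> hs_dot Y (X - X0) = 0.
  move=> [c _ <-]; rewrite /hs_dot tr_diag_mx map_diag_mx mul_diag_mx /mxtrace.
  rewrite (partition_big blk xpredT)//= big1// => x _.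
  rewrite (eq_bigr (fun i => (c x)^* * (X i i - mean x))); last first.
    by move=> i /eqP <-; rewrite !mxE eqxx mulr1n.
  rewrite -mulr_sumr sumrB sumr_const -[mean x *+ _]mulr_natr /mean.
  (* [blk] may miss a label: then the block is empty, the sum is empty and the quotient by zero is
     0. *)
  have [/eqP n0|n0] := eqVneq (#|[pred a | blk a == x]|%:R : C) 0.
    rewrite pnatr_eq0 in n0; rewrite big_pred0 ?(eqP n0) ?mul0r ?subr0 ?mulr0//.
    by move=> i; move/eqP/card0_eq/(_ i): n0; rewrite inE.
  by rewrite divfK// subrr mulr0.
have -> : cond_exp A X = X0.
  apply: xget_unique; first by split.
  move=> E1 [AE1 E1orth]; have [c1 _ E1E] := AE1.
  pose D := E1 - X0.
  have AD : A D.
    exists (fun x => c1 x - mean x) => //; rewrite /D -E1E /X0.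
    by apply/matrixP => i j; rewrite !mxE -mulrnBl.
  have DD : hs_dot D D = 0.
    rewrite [X in hs_dot _ X](_ : D = (X - X0) - (X - E1)); last first.
      by rewrite /D opprB [RHS]addrC addrA subrK.
    by rewrite /hs_dot mulmxBr raddfB /= -!/(hs_dot _ _) X0orth// E1orth// subrr.
  apply/matrixP => i j; apply/eqP; rewrite -subr_eq0.
  have -> : E1 i j - X0 i j = D i j by rewrite !mxE.
  move: DD; rewrite /hs_dot /mxtrace => /eqP.
  rewrite psumr_eq0 => [/allP DD|k0 _]; last first.
    by rewrite mxE sumr_ge0// => l0 _; rewrite !mxE mulrC mul_conjC_ge0.
  have := DD j (mem_index_enum j).
  rewrite /= mxE psumr_eq0 => [/allP Dj|l0 _]; last first.
    by rewrite !mxE mulrC mul_conjC_ge0.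
  by have := Dj i (mem_index_enum i); rewrite /= !mxE mulrC mul_conjC_eq0.
rewrite !mxE /mean -mulrA mulr_natl.
by have [->|_] := eqVneq k l; rewrite ?mulr1n ?mulr0n.
Qed.

Lemma cond_exp_delta a b k l :
  cond_exp A (delta_mx a b) k l = cond_exp_tensor a b k l.
Proof.
rewrite cond_expE /cond_exp_tensor; congr (_ / _).
have -> : \sum_(i | blk i == blk k) (delta_mx a b : M) i i =
    ((a == b) && (blk a == blk k))%:R.
  rewrite -sum_in_block (bigD1 a)//= big1 ?addr0 => [|i ia]; last first.
    by rewrite mxE (negbTE ia) mul0r.
  by rewrite mxE eqxx /=; case: (a == b); rewrite ?mul1r ?mul0r.
by rewrite -natrM mulnb andbCA.
Qed.

Definition defect (tau : M -> M) a b k l : C :=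
  tau (delta_mx a b) k l - cond_exp_tensor a b k l.

Variable tau : {ptws M -> M}.
Hypothesis Atau : Sigma A tau.

(** Range in the commutant puts [k] and [l] in one block. For the inputs, fixing block projections
    makes diagonal Choi entries between different blocks vanish, and a positive form with a zero
    diagonal entry has zero row and column there. *)
Lemma channel_support a b k l :
  ~~ [&& blk a == blk k, blk b == blk k & blk l == blk k] ->
  tau (delta_mx a b) k l = 0.
Proof.
case: Atau => -[ltau cp _] _ Afix nsup.
have [kl|kl] := eqVneq (blk l) (blk k); last first.
  suff : commutant A (tau (delta_mx a b)).
    by move/commutant_block_scalarsP; apply; rewrite eq_sym.
  move=> Y AY; have [_ /(_ (tau (delta_mx a b))) YT] := Afix _ AY.
  by apply/esym/YT; exists (delta_mx a b).
pose Q (p q : 'I_d * 'I_d) := tau (delta_mx p.1 q.1) p.2 q.2.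
have Qge0 x : 0 <= \sum_p \sum_q (x p)^* * Q p q * x q by exact: choi_form_ge0.
have Qdiag p : 0 <= Q p p.
  have := Qge0 (fun s => (s == p)%:R).
  rewrite (bigD1 p)//= [X in _ + X]big1 ?addr0 => [|s /negbTE sp]; last first.
    by rewrite big1// => t _; rewrite sp rmorph0 !mul0r.
  rewrite (bigD1 p)//= big1 ?addr0 => [|s /negbTE sp]; last by rewrite sp mulr0.
  by rewrite eqxx rmorph1 mul1r mulr1.
have Q0 c i : blk c != blk i -> Q (c, i) (c, i) = 0.
  move=> ci; pose P : M := diag_mx (\row_j (blk j == blk c)%:R).
  have AP : A P by exists (fun x => (x == blk c)%:R).
  have [PT _] := Afix _ AP.
  (* This sum is the entry (i, i) of the fixed projection onto the block of [c], which does not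
     contain [i]; its terms are nonnegative, so each is 0. *)
  have : \sum_(c' | blk c' == blk c) Q (c', i) (c', i) = 0.
    transitivity (tau P i i); last first.
      by rewrite PT !mxE eqxx eq_sym (negbTE ci).
    rewrite [in RHS](linear_matrix_sum _ ltau) summxE [LHS]big_mkcond.
    apply: eq_bigr => c' _; rewrite summxE (bigD1 c')//= big1 ?addr0 => [|c'' cc].
      by rewrite !mxE eqxx mulr1n; case: ifP; rewrite ?mul1r ?mul0r.
    by rewrite !mxE [c' == _]eq_sym (negbTE cc) mulr0n mul0r.
  move=> /eqP; rewrite psumr_eq0 => [/allP/(_ c (mem_index_enum c))|c' _ //].
  by rewrite eqxx => /eqP.
move: nsup; rewrite kl eqxx andbT negb_and => /orP[ak|bk].
  by have [] := psd_form_row0 (b, l) Qge0 (Q0 _ _ ak).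
rewrite -kl in bk.
by have [] := psd_form_row0 (a, k) Qge0 (Q0 _ _ bk).
Qed.

Lemma defect_support a b k l :
  ~~ [&& blk a == blk k, blk b == blk k & blk l == blk k] -> defect tau a b k l = 0.
Proof.
move=> nsup; rewrite /defect channel_support// /cond_exp_tensor.
case: and3P => [[/eqP ab /eqP kl /eqP ak]|_]; last by rewrite mul0r subrr.
by rewrite -ab -kl ak !eqxx in nsup.
Qed.

Lemma sum_delta_eq (F : 'I_d -> C) i : \sum_k (k == i)%:R * F k = F i.
Proof.
rewrite (bigD1 i)//= eqxx mul1r big1 ?addr0// => k /negbTE->.
by rewrite mul0r.
Qed.

Lemma defect_unital k l : \sum_a defect tau a a k l = 0.
Proof.
case: Atau => -[ltau _ _] utau _.
rewrite /defect sumrB; apply/eqP; rewrite subr_eq0; apply/eqP.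
transitivity (tau 1%:M k l).
  rewrite [in RHS](linear_matrix_sum _ ltau) summxE; apply: eq_bigr => a _.
  rewrite summxE (bigD1 a)//= big1 ?addr0 => [|b /negbTE ba].
    by rewrite !mxE eqxx mulr1n mul1r.
  by rewrite !mxE [a == _]eq_sym ba mulr0n mul0r.
rewrite utau !mxE /cond_exp_tensor -mulr_suml.
under eq_bigr do rewrite eqxx /= -mulnb natrM mulrC.
rewrite -mulr_suml (sum_block_const (blk := blk) (i := k) (v := 1)).
- by rewrite mulr1 mulrC mulrA mulVf ?block_size_neq0// mul1r.
- by move=> a /negbTE->.
- by move=> a ->; rewrite eqxx.
Qed.

Lemma defect_trace a b : \sum_k defect tau a b k k = 0.
Proof.
case: Atau => -[_ _ ttau] _ _.
rewrite /defect sumrB; apply/eqP; rewrite subr_eq0; apply/eqP.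
transitivity (\tr (tau (delta_mx a b))) => //; rewrite ttau.
transitivity ((a == b)%:R : C).
  rewrite /mxtrace (bigD1 a)//= big1 ?addr0 => [|i /negbTE ia]; last by rewrite mxE ia.
  by rewrite mxE eqxx.
rewrite (sum_block_const (blk := blk) (i := a) (v := (a == b)%:R / block_size a))
  => [|k ka|k ka].
- by rewrite mulrC divfK ?block_size_neq0.
- by rewrite /cond_exp_tensor [blk a == _]eq_sym (negbTE ka) !andbF mul0r.
- by rewrite /cond_exp_tensor (eq_block_size R ka) ka !eqxx /= andbT.
Qed.

End block_channels.

(** * The weight function *)

Section product_sums.
Context {R : realType} {d1 d2 : measure_display}
  {T1 : measurableType d1} {T2 : measurableType d2}.
Variables (mu1 : probability T1 R) (mu2 : probability T2 R).
Variables (D1 : set T1) (D2 : set T2).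
Hypotheses (mD1 : measurable D1) (mD2 : measurable D2).
Local Notation C := (complex R).

Lemma bounded_mfun_fst (f : T1 -> C) : bounded_mfun D1 f ->
  bounded_mfun (D1 `*` D2) (fun z => f z.1).
Proof.
move=> [rf jf [K fK]]; split.
- exact: (measurableT_comp rf).
- exact: (measurableT_comp jf).
- by exists K => -[x y] [/= /fK].
Qed.

Lemma bounded_mfun_snd (f : T2 -> C) : bounded_mfun D2 f ->
  bounded_mfun (D1 `*` D2) (fun z => f z.2).
Proof.
move=> [rf jf [K fK]]; split.
- exact: (measurableT_comp rf).
- exact: (measurableT_comp jf).
- by exists K => -[x y] [/= _ /fK].
Qed.

Lemma cintegral_prod_sum (P : finType) (al : P -> C)
    (g : P -> T1 -> C) (h : P -> T2 -> C) :
  (forall p, bounded_mfun D1 (g p)) -> (forall p, bounded_mfun D2 (h p)) ->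
  cintegral (mu1 \x mu2)%E (D1 `*` D2) (fun z => \sum_p al p * (g p z.1 * h p z.2)) =
  \sum_p al p * (cintegral mu1 D1 (g p) * cintegral mu2 D2 (h p)).
Proof.
move=> bg bh; have mD : measurable (D1 `*` D2) by exact: measurableX.
have fD := product_fin mu1 mu2 mD1 mD2.
have bgh p : bounded_mfun (D1 `*` D2) (fun z => g p z.1 * h p z.2).
  by apply: bounded_mfunM; [exact: bounded_mfun_fst|exact: bounded_mfun_snd].
rewrite cintegral_sum// => [|p]; last first.
  by apply: bounded_mfunM => //; exact: bounded_mfun_cst.
by apply: eq_bigr => p _; rewrite cintegralZl// cintegral_prod.
Qed.

Lemma bounded_mfun_prod_sum (P : finType) (al : P -> C)
    (g : P -> T1 -> C) (h : P -> T2 -> C) :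
  (forall p, bounded_mfun D1 (g p)) -> (forall p, bounded_mfun D2 (h p)) ->
  bounded_mfun (D1 `*` D2) (fun z => \sum_p al p * (g p z.1 * h p z.2)).
Proof.
move=> bg bh; apply: bounded_mfun_sum => p; apply: bounded_mfunM.
  exact: bounded_mfun_cst.
by apply: bounded_mfunM; [exact: bounded_mfun_fst|exact: bounded_mfun_snd].
Qed.

(** Both the weight and the entries of [beta] are finite sums of a function of U times a function of
    V; multiplied together they integrate to products of fourth moments. *)
Lemma cintegral_prod_sum2 (P Q : finType) (al : P -> C) (be : Q -> C)
    (g : P -> T1 -> C) (h : P -> T2 -> C) (g' : Q -> T1 -> C) (h' : Q -> T2 -> C) :
  (forall p, bounded_mfun D1 (g p)) -> (forall p, bounded_mfun D2 (h p)) ->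
  (forall p, bounded_mfun D1 (g' p)) -> (forall p, bounded_mfun D2 (h' p)) ->
  cintegral (mu1 \x mu2)%E (D1 `*` D2) (fun z =>
    (\sum_p al p * (g p z.1 * h p z.2)) * (\sum_q be q * (g' q z.1 * h' q z.2))) =
  \sum_p \sum_q al p * be q * (cintegral mu1 D1 (fun x => g p x * g' q x) *
    cintegral mu2 D2 (fun x => h p x * h' q x)).
Proof.
move=> bg bh bg' bh'; rewrite pair_bigA /=.
rewrite -(cintegral_prod_sum (fun pq : P * Q => al pq.1 * be pq.2)
  (g := fun pq x => g pq.1 x * g' pq.2 x) (h := fun pq x => h pq.1 x * h' pq.2 x)).
- apply: eq_cintegral => z _; rewrite big_distrlr /= pair_bigA /=.
  by apply: eq_bigr => -[p q] _ /=; ring.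
- by move=> p; exact: bounded_mfunM.
- by move=> p; exact: bounded_mfunM.
Qed.

End product_sums.

Section weight.
Variables (R : realType) (d : nat) (I : finType) (blk : 'I_d -> I).
Local Notation C := (complex R).
Local Notation M := 'M[C]_d.
Local Notation A := (block_scalars (R := R) blk).
Local Notation G := (unitary_group (commutant A)).
Local Notation block_size := (block_size R blk).
Local Notation weingarten_q := (weingarten_q R blk).

Local Notation GG :=
  ((G : set (borel_matrix R d)) `*` (G : set (borel_matrix R d))).

(** For n > 1, the inverse of n times the sum over j of q_ij^2, that is of (n - 1) / (n^2 - 1)^2. It
    is 0 for n = 1. *)
Definition weight_coef (i : 'I_d) : C := (block_size i + 1) ^+ 2 * (block_size i - 1).

(* The index p is (i, ((a, k), (b, l))), pairing rows and columns as in the Choi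
   form of a channel. *)
Definition weight_sum (f : 'I_d -> 'I_d -> 'I_d -> 'I_d -> C) (U V : M) : C :=
  \sum_(p : 'I_d * (('I_d * 'I_d) * ('I_d * 'I_d)))
    weight_coef p.1 * f p.2.1.1 p.2.2.1 p.2.1.2 p.2.2.2 *
    (entry_prod p.2.2.2 p.2.1.2 p.1 U * entry_prod p.2.1.1 p.2.2.1 p.1 V).

Lemma beta_entry (U V X : M) x y : beta U V X x y =
  \sum_(q : 'I_d * ('I_d * 'I_d)) X q.2.1 q.2.2 *
    (entry_prod x y q.1 U * entry_prod q.2.2 q.2.1 q.1 V).
Proof.
rewrite -(pair_bigA _ (fun j ce => X ce.1 ce.2 *
  (entry_prod x y j U * entry_prod ce.2 ce.1 j V))) /=.
rewrite /beta /Ad /Delta /= mul_mx_diag mxE; apply: eq_bigr => j _.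
rewrite -(pair_bigA _ (fun c e => X c e *
  (entry_prod x y j U * entry_prod e c j V))) /= exchange_big /=.
rewrite !mxE mulr_sumr mulr_suml; apply: eq_bigr => e _.
rewrite mxE mulr_suml mulr_sumr mulr_suml; apply: eq_bigr => c _.
by rewrite !mxE conjCK /entry_prod; ring.
Qed.

(** For fixed i the sum is the Choi form of [tau] at the vector with entries conj(V_ai) U_ki, minus
    the same form for the conditional expectation. Both are nonnegative and the coefficient is
    real. *)
Lemma weight_sum_real tau (U V : M) : Sigma A tau ->
  weight_sum (defect blk tau) U V \is Num.real.
Proof.
move=> [[_ cp _] _ _]; rewrite /weight_sum.
rewrite -(pair_bigA _ (fun i st => weight_coef i *
    defect blk tau st.1.1 st.2.1 st.1.2 st.2.2 *
    (entry_prod st.2.2 st.1.2 i U * entry_prod st.1.1 st.2.1 i V))) /=.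
apply: rpred_sum => i _.
rewrite (eq_bigr (fun st => weight_coef i *
    (defect blk tau st.1.1 st.2.1 st.1.2 st.2.2 *
    (entry_prod st.2.2 st.1.2 i U * entry_prod st.1.1 st.2.1 i V)))); last first.
  by move=> st _; rewrite -[LHS]mulrA.
rewrite -mulr_sumr; apply: rpredM.
  have sr : block_size i \is Num.real by exact: realn.
  apply: rpredM; last by apply: rpredB; [exact: sr|exact: rpred1].
  by apply: rpredX; apply: rpredD; [exact: sr|exact: rpred1].
rewrite /defect.
under eq_bigr do rewrite mulrBl.
rewrite sumrB; apply: rpredB; apply: ger0_real.
  have := choi_form_ge0 (fun s => (V s.1 i)^* * U s.2 i) cp.
  rewrite pair_bigA /= (eq_bigr (fun st => tau (delta_mx st.1.1 st.2.1) st.1.2 st.2.2 *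
    (entry_prod st.2.2 st.1.2 i U * entry_prod st.1.1 st.2.1 i V)))// => st _.
  by rewrite rmorphM /= conjCK /entry_prod; ring.
apply: sumr_ge0 => -[[a k] [b l]] _ /=; rewrite /cond_exp_tensor.
case: and3P => [[/eqP -> /eqP -> _]|_]; last by rewrite !mul0r.
apply: mulr_ge0; first by apply: divr_ge0; exact: ler0n.
by apply: mulr_ge0; exact: mul_conjC_ge0.
Qed.

Variable mu : probability (borel_matrix R d) R.
Hypothesis mu_haar : normalized_haar G mu.
Local Notation moment2 := (moment2 blk mu).
Local Notation moment4 := (moment4 blk mu).

(** The p term contains the trace of [g] over the block of [i]: the full trace if this is the block
    [x] carrying [g], an empty contribution otherwise, hence 0 in both cases. The q term returns [g]
    with its indices exchanged. *)
Lemma moment4_contract (g : 'I_d -> 'I_d -> C) (x : I) i c e j :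
  (forall a b, ~~ ((blk a == x) && (blk b == x)) -> g a b = 0) ->
  \sum_a g a a = 0 ->
  \sum_a \sum_b g a b * moment4 a b i c e j =
  weingarten_q i j * ((blk c == blk i) && (blk e == blk i))%:R * g e c.
Proof.
move=> gx g0.
pose bJ : C := ((blk c == blk j) && (blk e == blk j))%:R.
pose K1 := bJ * weingarten_p R blk i j * (c == e)%:R.
pose K2 := bJ * weingarten_q i j * ((blk c == blk i) && (blk e == blk i))%:R.
transitivity (\sum_a \sum_b ((b == a)%:R * (K1 * (g a a * (blk a == blk i)%:R)) +
    (b == c)%:R * ((a == e)%:R * (K2 * g e c)))).
  apply: eq_bigr => a _; apply: eq_bigr => b _.
  rewrite (moment4E mu_haar) !mulrDr; congr (_ + _).
    rewrite /K1 /bJ; have [<-|ab] := eqVneq a b; last first.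
      by rewrite /= !mulr0 mul0r.
    by case: (blk a == blk i); rewrite /= ?mulr0n ?mulr1n; ring.
  rewrite /K2 /bJ [b == c]eq_sym; have [<-|ae] := eqVneq a e; last first.
    by rewrite /= !mul0r !mulr0.
  have [<-|cb] := eqVneq c b; last by rewrite /= !mul0r !mulr0.
  by case: (blk a == blk i); case: (blk c == blk i);
    rewrite /= ?mulr0n ?mulr1n; ring.
under eq_bigr do rewrite big_split /= !sum_delta_eq.
rewrite big_split /= -mulr_sumr !sum_delta_eq -/K2.
have -> : \sum_a g a a * (blk a == blk i)%:R = 0.
  have [xi|xi] := eqVneq x (blk i).
    rewrite -[RHS]g0; apply: eq_bigr => a _.
    have [ai|ai] := eqVneq (blk a) (blk i); first by rewrite mulr1.
    by rewrite gx ?mul0r// xi (negbTE ai).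
  rewrite big1// => a _; have [ai|ai] := eqVneq (blk a) (blk i); last by rewrite mulr0.
  by rewrite gx ?mul0r// ai [blk i == x]eq_sym (negbTE xi).
rewrite mulr0 add0r /K2 /bJ; congr (_ * _).
have [ij|ij] := eqVneq (blk i) (blk j); last first.
  by rewrite /weingarten_q (negbTE ij) !(mulr0, mul0r).
by rewrite ij; case: (_ && _); rewrite ?(mul0r, mulr0, mul1r, mulr1).
Qed.


Section defect_tensor.
Variable f : 'I_d -> 'I_d -> 'I_d -> 'I_d -> C.
Hypothesis f_support : forall a b k l,
  ~~ [&& blk a == blk k, blk b == blk k & blk l == blk k] -> f a b k l = 0.
Hypothesis f_unital : forall k l, \sum_a f a a k l = 0.
Hypothesis f_trace : forall a b, \sum_k f a b k k = 0.

(** The V moments are contracted first, over [a] and [b], where the sum over a = b vanishes by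
    [f_unital]; then the U moments over [l] and [k], where [f_trace] plays this role. Each
    contraction contributes one factor q. *)
Lemma tensor_contract i j c e x y :
  \sum_(st : ('I_d * 'I_d) * ('I_d * 'I_d)) f st.1.1 st.2.1 st.1.2 st.2.2 *
    (moment4 st.2.2 st.1.2 i x y j * moment4 st.1.1 st.2.1 i e c j) =
  weingarten_q i j ^+ 2 * (blk i == blk x)%:R * f c e x y.
Proof.
rewrite -(pair_bigA _ (fun s t => f s.1 t.1 s.2 t.2 *
    (moment4 t.2 s.2 i x y j * moment4 s.1 t.1 i e c j))) /=.
rewrite -(pair_bigA _ (fun a k => \sum_t f a t.1 k t.2 *
    (moment4 t.2 k i x y j * moment4 a t.1 i e c j))) /= exchange_big /=.
transitivity (\sum_k \sum_l (\sum_a \sum_b f a b k l * moment4 a b i e c j) *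
    moment4 l k i x y j).
  apply: eq_bigr => k _.
  under [RHS]eq_bigr do rewrite mulr_suml.
  rewrite [RHS]exchange_big /=; apply: eq_bigr => a _.
  under [RHS]eq_bigr do rewrite mulr_suml.
  rewrite [RHS]exchange_big /= -(pair_bigA _ (fun b l => f a b k l *
    (moment4 l k i x y j * moment4 a b i e c j))) /=.
  by apply: eq_bigr => b _; apply: eq_bigr => l _; ring.
under eq_bigr => k _.
  under eq_bigr => l _.
    rewrite (moment4_contract (x := blk k)) => [|a b ab|//]; last first.
      by apply: f_support; apply: contra ab => /and3P[-> ->].
    rewrite -mulrA; over.
  over.
rewrite exchange_big /=.
under eq_bigr do rewrite -mulr_sumr.
rewrite -mulr_sumr (moment4_contract (g := fun l k => f c e k l) (x := blk c));
  first last.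
- exact: f_trace.
- move=> l k lk; apply: f_support; apply: contra lk => /and3P[/eqP ck _ /eqP lk].
  by rewrite lk ck eqxx.
have [/and3P[/eqP cx /eqP ex /eqP yx]|nsup] :=
    boolP [&& blk c == blk x, blk e == blk x & blk y == blk x]; last first.
  by rewrite f_support// !mulr0.
rewrite cx ex yx !andbb [blk x == _]eq_sym.
by case: (blk i == blk x); rewrite ?(mulr0, mul0r, mulr1) ?expr2 ?mulrA.
Qed.

Lemma sum_weingarten_q i : \sum_j weingarten_q i j ^+ 2 =
  (1 - (block_size i)^-1) / (block_size i ^+ 2 - 1) ^+ 2.
Proof.
set n := block_size i; pose D := ((n ^+ 2 - 1) ^+ 2)^-1.
transitivity (\sum_j ((j == i)%:R * ((1 - 2 / n) * D) +
    (blk j == blk i)%:R * (n ^- 2 * D))).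
  apply: eq_bigr => j _; rewrite /weingarten_q -/n [j == i]eq_sym [blk j == _]eq_sym.
  have [ij|ij] := eqVneq (blk i) (blk j); last first.
    rewrite (negbTE (contra_neq _ ij)) => [|->//].
    by rewrite !mul0r addr0 expr0n.
  rewrite mul1r expr_div_n -/D -exprVn.
  by case: (i == j); rewrite /= ?mulr0n ?mulr1n; ring.
rewrite big_split /= (sum_delta_eq (fun=> (1 - 2 / n) * D) i).
rewrite (sum_block_const (blk := blk) (i := i) (v := n ^- 2 * D)).
- rewrite -/n -/D mulrA -mulrDl; congr (_ * _).
  by field; exact: block_size_neq0.
- by move=> k /negbTE->; rewrite mul0r.
- by move=> k ->; rewrite eqxx mul1r.
Qed.

(** In a block of size n > 1 its n values of i contribute equally, and [weight_coef] makes the total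
    1. In a block of size 1 the coefficient is 0, but there the only candidate entry of [f] is a
    whole sum of [f_unital], so it vanishes. *)
Lemma weight_normalization c e x y :
  (\sum_i \sum_j weight_coef i * (weingarten_q i j ^+ 2 * (blk i == blk x)%:R)) *
    f c e x y = f c e x y.
Proof.
have [n1|n1] := eqVneq (block_size x) 1.
  suff -> : f c e x y = 0 by rewrite mulr0.
  have only k : blk k = blk x -> k = x.
    move=> kx; have /card_le1_eqP : (#|[pred k | blk k == blk x]| <= 1)%N.
      by move/eqP: n1; rewrite -[1]/(1%:R) eqr_nat => /eqP->.
    by apply; rewrite inE ?kx.
  have [/and3P[/eqP/only-> /eqP/only-> /eqP/only->]|nsup] :=
    boolP [&& blk c == blk x, blk e == blk x & blk y == blk x]; last exact: f_support.
  rewrite -[RHS](f_unital x x) (bigD1 x)//= big1 ?addr0// => a ax.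
  apply: f_support; apply: contra ax => /and3P[/eqP/only-> _ _].
  exact: eqxx.
rewrite -[RHS]mul1r; congr (_ * _).
rewrite (sum_block_const (blk := blk) (i := x) (v := (block_size x)^-1)).
- by rewrite divff ?block_size_neq0.
- by move=> i ix; rewrite big1// => j _; rewrite (negbTE ix) !mulr0.
move=> i ix; rewrite -mulr_sumr -mulr_suml ix eqxx mulr1 sum_weingarten_q /weight_coef.
rewrite (eq_block_size R ix); have n0 := block_size_neq0 R blk x.
have np1 : block_size x + 1 != 0 by rewrite natr1 pnatr_eq0.
have nm1 : block_size x - 1 != 0 by rewrite subr_eq0.
have nn : block_size x ^+ 2 - 1 = (block_size x + 1) * (block_size x - 1) by ring.
rewrite nn; field.
by rewrite n0 np1 nm1.
Qed.

Lemma weight_integral X x y :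
  cintegral (mu \x mu)%E (G `*` G)
    (fun z => (1 + weight_sum f z.1 z.2) * beta z.1 z.2 X x y) =
  \sum_c \sum_e X c e * (cond_exp_tensor R blk c e x y + f c e x y).
Proof.
have mG : measurable (G : set (borel_matrix R d)) by exact: measurable_unitary_group.
have be a b i  := @bounded_mfun_entry_prod R d I blk a b i.
have fD := product_fin mu mu mG mG.
have mD : measurable GG.
  exact: measurableX.
have bB : bounded_mfun GG (fun z : borel_matrix R d * borel_matrix R d =>
    beta z.1 z.2 X x y).
  rewrite (_ : (fun z => _) = fun z => \sum_(q : 'I_d * ('I_d * 'I_d))
      X q.2.1 q.2.2 * (entry_prod x y q.1 z.1 * entry_prod q.2.2 q.2.1 q.1 z.2)).
    exact: (@bounded_mfun_prod_sum _ _ _ (borel_matrix R d) (borel_matrix R d) _ _ _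
      (fun q => X q.2.1 q.2.2) (fun q => entry_prod x y q.1)
      (fun q => entry_prod q.2.2 q.2.1 q.1)).
  by apply/funext => z; rewrite beta_entry.
have bW : bounded_mfun GG (fun z : borel_matrix R d * borel_matrix R d =>
    weight_sum f z.1 z.2).
  exact: (@bounded_mfun_prod_sum _ _ _ (borel_matrix R d) (borel_matrix R d) _ _ _
    (fun p => weight_coef p.1 * f p.2.1.1 p.2.2.1 p.2.1.2 p.2.2.2)
    (fun p => entry_prod p.2.2.2 p.2.1.2 p.1)
    (fun p => entry_prod p.2.1.1 p.2.2.1 p.1)).
transitivity (cintegral (mu \x mu)%E (G `*` G) (fun z => beta z.1 z.2 X x y) +
  cintegral (mu \x mu)%E (G `*` G)
    (fun z => weight_sum f z.1 z.2 * beta z.1 z.2 X x y)).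
  rewrite -cintegralD//; last exact: bounded_mfunM.
  by apply: eq_cintegral => z _; rewrite mulrDl mul1r.
under eq_bigr do (under eq_bigr do rewrite mulrDr; rewrite big_split /=).
rewrite big_split /=; congr (_ + _).
  transitivity (cintegral (mu \x mu)%E (G `*` G) (fun z =>
    \sum_(q : 'I_d * ('I_d * 'I_d)) X q.2.1 q.2.2 *
    (entry_prod x y q.1 z.1 * entry_prod q.2.2 q.2.1 q.1 z.2))).
    by apply: eq_cintegral => z _; rewrite beta_entry.
  rewrite (@cintegral_prod_sum _ _ _ (borel_matrix R d) (borel_matrix R d)
    _ _ _ _ mG mG _
    (fun q => X q.2.1 q.2.2) (fun q => entry_prod x y q.1)
    (fun q => entry_prod q.2.2 q.2.1 q.1))//.
  rewrite -(pair_bigA _ (fun j ce => X ce.1 ce.2 *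
    (moment2 x y j * moment2 ce.2 ce.1 j))) /= exchange_big /=.
  rewrite -(pair_bigA _ (fun c e => \sum_j X c e *
    (moment2 x y j * moment2 e c j))) /=.
  apply: eq_bigr => c _; apply: eq_bigr => e _; rewrite -mulr_sumr; congr (_ * _).
  (* Each of the n columns j of the block contributes a product of two second moments 1/n, which
     leaves the factor 1/n of the conditional expectation. *)
  rewrite (sum_block_const (blk := blk) (i := x)
    (v := [&& c == e, x == y & blk c == blk x]%:R / block_size x ^+ 2)) => [|j jx|j jx].
  - by rewrite /cond_exp_tensor; field; exact: block_size_neq0.
  - rewrite !(moment2E mu_haar) [blk x == _]eq_sym (negbTE jx).
    by rewrite andbF !mul0r.
  - rewrite !(moment2E mu_haar) (eq_block_size R jx) jx eqxx andbT.
    rewrite mulrACA -natrM mulnb -invfM -expr2; congr (_%:R / _).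
    by have [->|_] := eqVneq c e; rewrite /= ?andbF.
transitivity (\sum_(q : 'I_d * ('I_d * 'I_d)) \sum_i weight_coef i * X q.2.1 q.2.2 *
  (weingarten_q i q.1 ^+ 2 * (blk i == blk x)%:R * f q.2.1 q.2.2 x y)).
  transitivity (cintegral (mu \x mu)%E (G `*` G) (fun z => weight_sum f z.1 z.2 *
    \sum_(q : 'I_d * ('I_d * 'I_d)) X q.2.1 q.2.2 *
    (entry_prod x y q.1 z.1 * entry_prod q.2.2 q.2.1 q.1 z.2))).
    by apply: eq_cintegral => z _; rewrite beta_entry.
  rewrite (@cintegral_prod_sum2 _ _ _ (borel_matrix R d) (borel_matrix R d)
    _ _ _ _ mG mG _ _
    (fun p => weight_coef p.1 * f p.2.1.1 p.2.2.1 p.2.1.2 p.2.2.2)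
    (fun q => X q.2.1 q.2.2)
    (fun p => entry_prod p.2.2.2 p.2.1.2 p.1)
    (fun p => entry_prod p.2.1.1 p.2.2.1 p.1)
    (fun q => entry_prod x y q.1) (fun q => entry_prod q.2.2 q.2.1 q.1))//.
  rewrite exchange_big /=; apply: eq_bigr => -[j [c e]] _ /=.
  rewrite -(pair_bigA _ (fun i st =>
    weight_coef i * f st.1.1 st.2.1 st.1.2 st.2.2 * X c e *
    (moment4 st.2.2 st.1.2 i x y j * moment4 st.1.1 st.2.1 i e c j))) /=.
  apply: eq_bigr => i _; rewrite -tensor_contract mulr_sumr.
  by apply: eq_bigr => st _; ring.
rewrite -(pair_bigA _ (fun j ce => \sum_i weight_coef i * X ce.1 ce.2 *
  (weingarten_q i j ^+ 2 * (blk i == blk x)%:R * f ce.1 ce.2 x y))) /= exchange_big /=.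
rewrite -(pair_bigA _ (fun c e => \sum_j \sum_i weight_coef i * X c e *
  (weingarten_q i j ^+ 2 * (blk i == blk x)%:R * f c e x y))) /=.
apply: eq_bigr => c _; apply: eq_bigr => e _.
rewrite -[in RHS]weight_normalization exchange_big /= mulr_suml mulr_sumr.
apply: eq_bigr => i _; rewrite mulr_suml mulr_sumr.
by apply: eq_bigr => j _; ring.
Qed.

End defect_tensor.

End weight.

Lemma block_scalarsE (R : realType) (r : nat) (m : 'I_r -> nat) :
  scalar_blocks (R := R) m = block_scalars (R := R) (@tagnat.sig1 r m).
Proof.
rewrite /scalar_blocks /block_scalars; congr (_ @` _); apply/funext => c.
rewrite (_ : (\row_j c (tagnat.sig1 j)) = \mxrow_k (const_mx (c k) : 'rV_(m k))).
  rewrite diag_mxrow; apply: eq_mxdiag => k.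
  by rewrite diag_const_mx.
by apply/rowP => j; rewrite !mxE.
Qed.

(** * The weight as a continuous real function *)

Section weight_continuity.
Variables (R : realType) (d : nat) (I : finType) (blk : 'I_d -> I).
Local Notation C := (complex R).
Local Notation M := 'M[C]_d.

(** The sum is real only for channels in [Sigma]; the real part extends the weight to a function
    defined and continuous for arbitrary maps and matrices. *)
Definition weight (z : {ptws M -> M} * M * M) : R :=
  1 + complex.Re (weight_sum blk (defect blk z.1.1) z.1.2 z.2).

Lemma continuous_entry_prod (T : topologicalType) (g : T -> M) a b i :
  continuous g -> continuous (fun z => entry_prod a b i (g z)).
Proof.
move=> cg; have cgk k : continuous (fun z => g z k i).
  move=> z; apply: (@continuous_comp _ _ _ g (fun X : M => X k i)); first exact: cg.
  exact: continuous_entry.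
by apply: continuous_funCM => //; exact: continuous_funC_conj.
Qed.

(** [tau] enters only through its values at the matrix units, and evaluation at a fixed matrix is
    continuous for pointwise convergence. *)
Lemma continuous_weight : continuous weight.
Proof.
have c11 : continuous (fun z : {ptws M -> M} * M * M => z.1.1).
  by move=> z; apply: (@continuous_comp _ _ _ fst fst); exact: cvg_fst.
have c12 : continuous (fun z : {ptws M -> M} * M * M => z.1.2).
  move=> z; apply: (@continuous_comp _ _ _ fst snd).
    exact: cvg_fst.
  exact: cvg_snd.
have c2 : continuous (fun z : {ptws M -> M} * M * M => z.2).
  by move=> z; exact: cvg_snd.
have ctau Y k l : continuous (fun z : {ptws M -> M} * M * M => (z.1.1 : M -> M) Y k l).
  move=> z; apply: (@continuous_comp _ _ _ (fun z : {ptws M -> M} * M * M => z.1.1)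
    (fun t : {ptws M -> M} => (t : M -> M) Y k l)); first exact: c11.
  apply: (@continuous_comp _ _ _ (fun t : {ptws M -> M} => (t : M -> M) Y)
    (fun X : M => X k l)).
    exact: (@proj_continuous _ (fun=> M) Y).
  exact: continuous_entry.
have ep1 a b i : continuous (fun z : {ptws M -> M} * M * M => entry_prod a b i z.1.2).
  exact: continuous_entry_prod c12.
have ep2 a b i : continuous (fun z : {ptws M -> M} * M * M => entry_prod a b i z.2).
  exact: continuous_entry_prod c2.
have cw : continuous (fun z : {ptws M -> M} * M * M =>
    weight_sum blk (defect blk z.1.1) z.1.2 z.2).
  apply: continuous_funC_sum => p; apply: continuous_funCM.
    apply: continuous_funCM; first exact: continuous_funC_cst.
    apply: continuous_funCB; first exact: ctau.
    exact: continuous_funC_cst.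
  apply: continuous_funCM; first exact: ep1.
  exact: ep2.
move=> z; apply: cvgD; first exact: cvg_cst.
apply: (@continuous_comp _ _ _ (fun z : {ptws M -> M} * M * M =>
    weight_sum blk (defect blk z.1.1) z.1.2 z.2) (@complex.Re R)); first exact: cw.
exact: continuous_Re.
Qed.

End weight_continuity.

Local Open Scope complex_scope.

Theorem theorem5p3 (R : realType) (r : nat) (m : 'I_r -> nat)
    (r_gt0 : (0 < r)%N) (m_gt0 : forall k, (0 < m k)%N)
    (mu : probability (borel_matrix R (\sum_(k < r) m k)) R)
    (mu_haar : normalized_haar (unitary_group (commutant (scalar_blocks m))) mu) :
  let M := 'M[R[i]]_(\sum_(k < r) m k) in
  let A : set M := scalar_blocks m in
  let G : set M := unitary_group (commutant A) in
  exists rho : {ptws M -> M} * M * M -> R,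
    [/\ {within Sigma A `*` G `*` G, continuous rho},
        forall tau, Sigma A tau -> forall X : M,
          tau X = mxintegral (mu \x mu)%E (G `*` G)
            (fun UV => (rho (tau, UV.1, UV.2))%:C *: beta UV.1 UV.2 X) &
        forall U V, G U -> G V -> rho (cond_exp A, U, V) = 1].
Proof.
move=> M A G; pose blk := @tagnat.sig1 r m.
have AE : A = block_scalars blk by exact: block_scalarsE.
have mu_haar' : normalized_haar (unitary_group (commutant (block_scalars blk))) mu.
  by rewrite -AE.
exists (weight blk); split.
- by apply: continuous_subspaceT; exact: continuous_weight.
- move=> tau; rewrite AE => Atau X; apply/matrixP => x y; rewrite mxE.
  have [[ltau _ _] _ _] := Atau.
  transitivity (\sum_c \sum_e X c e *
    (cond_exp_tensor R blk c e x y + defect blk tau c e x y)).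
    rewrite {1}(linear_matrix_sum X ltau) summxE; apply: eq_bigr => c _.
    rewrite summxE; apply: eq_bigr => e _.
    by rewrite mxE /defect addrC subrK.
  rewrite -(weight_integral mu_haar').
  + rewrite /G AE; apply: eq_cintegral => z _; rewrite [RHS]mxE; congr (_ * _).
    (* For a channel in [Sigma] taking the real part loses nothing, so the complex weight is
       recovered. *)
    rewrite /weight rmorphD rmorph1 /= RRe_real//; exact: weight_sum_real.
  + by move=> *; exact: defect_support.
  + by move=> *; exact: defect_unital.
  + by move=> *; exact: defect_trace.
move=> U V _ _; rewrite /weight (_ : weight_sum _ _ _ _ = 0) ?addr0//.
rewrite /weight_sum big1// => p _.
(* The defect of the conditional expectation is zero entry by entry. *)
by rewrite /defect /= AE cond_exp_delta subrr mulr0 mul0r.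
Qed.
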